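(* Let $K\subseteq\mathbb{R}^d$ be a convex body of volume one, and let $\mathcal F$ be a family of positive homothets of $K$ whose total volume is at least \[\begin{cases}(d^3\ln d\cdot\vartheta(K)+e)\,2^d, & \text{if } K=-K,\\[2pt] d^3\ln d\cdot\vartheta(K)\binom{2d}{d}+e\cdot 4^d, & \text{in general}.\end{cases}\] Then $\mathcal F$ permits a translative covering of $K$.
   Context: A convex body is a compact convex subset of $\mathbb{R}^d$ with nonempty interior; a positive homothet of $K$ is a set $\lambda K+x$ with $\lambda>0$, $x\in\mathbb{R}^d$. $\mathcal F$ permits a translative covering of $A$ if one can select a translation vector $x_F$ for each $F\in\mathcal F$ such that $A\subseteq\bigcup_{F\in\mathcal F}(x_F+F)$. $\vartheta(K)$ is the translative covering density of $K$: the infimum of the densities $\limsup_{r\to\infty}\frac{\sum_{i:\,C_i\subseteq rB}\operatorname{vol}(C_i)}{\operatorname{vol}(rB)}$ over all coverings $\{C_i\}$ of $\mathbb{R}^d$ by translates of $K$ ($B$ the Euclidean unit ball). *)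

(* Defs.v *)
From Stdlib Require Import Reals List.
Open Scope R_scope.

Definition pt := nat -> R.
Definition in_Rd (d : nat) (x : pt) : Prop := forall i, (d <= i)%nat -> x i = 0.

Definition sqnorm (d : nat) (x : pt) : R :=
  fold_right Rplus 0 (map (fun i => (x i) ^ 2) (seq 0 d)).
Definition dist (d : nat) (x y : pt) : R := sqrt (sqnorm d (fun i => x i - y i)).

Definition ptadd (x y : pt) : pt := fun i => x i + y i.
Definition ptsub (x y : pt) : pt := fun i => x i - y i.
Definition ptscal (l : R) (x : pt) : pt := fun i => l * x i.
Definition ptopp (x : pt) : pt := fun i => - x i.

Definition convex_body (d : nat) (K : pt -> Prop) : Prop :=
  (forall x, K x -> in_Rd d x) /\
  (forall x y t, K x -> K y -> 0 <= t <= 1 ->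
     K (ptadd (ptscal t x) (ptscal (1 - t) y))) /\
  (exists M, forall x, K x -> forall i, Rabs (x i) <= M) /\
  (forall x, in_Rd d x ->
     (forall eps, eps > 0 -> exists y, K y /\ dist d x y < eps) -> K x) /\
  (exists x r, r > 0 /\ forall y, in_Rd d y -> dist d x y < r -> K y).

Definition in_box (d : nat) (B : pt * pt) (y : pt) : Prop :=
  in_Rd d y /\ forall i, (i < d)%nat -> fst B i <= y i <= snd B i.
Definition box_vol (d : nat) (B : pt * pt) : R :=
  fold_right Rmult 1 (map (fun i => Rmax 0 (snd B i - fst B i)) (seq 0 d)).

Definition box_cover_sums (d : nat) (A : pt -> Prop) (s : R) : Prop :=
  exists Bs : nat -> pt * pt,
    (forall y, A y -> exists n, in_box d (Bs n) y) /\
    Un_cv (fun N => sum_f_R0 (fun n => box_vol d (Bs n)) N) s.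

Definition is_glb (S : R -> Prop) (m : R) : Prop :=
  (forall s, S s -> m <= s) /\ (forall m', (forall s, S s -> m' <= s) -> m' <= m).

(* vol A = v  (Lebesgue outer measure; equals the volume for convex bodies) *)
Definition is_vol (d : nat) (A : pt -> Prop) (v : R) : Prop :=
  is_glb (box_cover_sums d A) v.

Fixpoint sum_list {I : Type} (v : I -> R) (l : list I) : R :=
  match l with nil => 0 | i :: l' => v i + sum_list v l' end.

Definition translate (x : pt) (K : pt -> Prop) : pt -> Prop :=
  fun y => K (ptsub y x).
Definition homothet (lam : R) (x : pt) (K : pt -> Prop) : pt -> Prop :=
  fun y => exists k, K k /\ y = ptadd (ptscal lam k) x.
Definition ball (d : nat) (r : R) : pt -> Prop :=
  fun y => in_Rd d y /\ sqrt (sqnorm d y) <= r.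

Definition covers_Rd (d : nat) {I : Type} (C : I -> pt -> Prop) : Prop :=
  forall y, in_Rd d y -> exists i, C i y.

(* limsup_{r->oo} (sum_{i : C_i ⊆ rB} vol C_i) / vol(rB) <= t
   (the sum may be infinite; it is the sup of its finite partial sums) *)
Definition density_le (d : nat) {I : Type} (C : I -> pt -> Prop) (t : R) : Prop :=
  forall eps, eps > 0 -> exists R0, forall r, r >= R0 ->
    forall (v : I -> R) (vb : R),
      (forall i, is_vol d (C i) (v i)) -> is_vol d (ball d r) vb ->
      forall l : list I, NoDup l ->
        (forall i, In i l -> forall y, C i y -> ball d r y) ->
        sum_list v l <= (t + eps) * vb.

Definition covering_density_values (d : nat) (K : pt -> Prop) (t : R) : Prop :=
  exists (I : Type) (x : I -> pt),
    (forall i, in_Rd d (x i)) /\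
    covers_Rd d (fun i => translate (x i) K) /\
    density_le d (fun i => translate (x i) K) t.

Definition is_theta (d : nat) (K : pt -> Prop) (th : R) : Prop :=
  is_glb (covering_density_values d K) th.

Definition total_vol_ge (d : nat) {I : Type} (F : I -> pt -> Prop) (T : R) : Prop :=
  exists v : I -> R, (forall i, is_vol d (F i) (v i)) /\
    forall eps, eps > 0 -> exists l : list I, NoDup l /\ sum_list v l >= T - eps.

Definition permits_translative_covering (d : nat) {I : Type}
  (F : I -> pt -> Prop) (A : pt -> Prop) : Prop :=
  exists t : I -> pt, (forall i, in_Rd d (t i)) /\
    forall y, A y -> exists i, translate (t i) (F i) y.

Definition centrally_symmetric (K : pt -> Prop) : Prop :=
  forall x, K x <-> K (ptopp x).

(* Main.v *)
(* The covering density is at least 1, since the translates of K inside a large ball cover a slightly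
   smaller ball. It therefore suffices to cover K by finitely many homothets lam_i K such that the
   sum of lam_i^d is at least c (d^3 ln d + e) - 1, where c = 2^d if K = -K and c = C(2d, d) in
   general. This is an affine invariant problem, so a basis of almost maximal determinant with
   vectors in K - K lets us assume that K contains a unit cube and lies in a cube of side about d.

   For d <= 3 the cubes inscribed in the homothets, rounded down to dyadic sizes, already cover the
   circumscribed cube. For d >= 4, let delta be the least ratio among the largest homothets of total
   volume about 15 c d ln d. Shrink these by the factor 1 - 1/(2d) and place them greedily: by the
   Rogers-Shephard inequality vol(K - K) <= c vol(K), an optimal translate of lam K covers at least
   the fraction lam^d / c of what is left, so the uncovered part has volume at most about d^(-5d).
   Undoing the shrinking covers everything but a few grid cubes of side delta / (8d), and the
   remaining homothets, of ratio at most delta and of total volume at least 1, cover these cubes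
   dyadically.

   Volumes are only needed up to a common factor, and V(A) is the limit of s^(-d) times the number
   of lattice points in s A + t, which for convex A exists uniformly in t. *)
Require Import Defs.
From Stdlib Require Import Reals List.
From Stdlib Require Import Lra Lia Classical ClassicalEpsilon FunctionalExtensionality.
Open Scope R_scope.

(** * Volumes of homothets and the covering density *)

Lemma is_glb_unique (S : R -> Prop) (a b : R) : is_glb S a -> is_glb S b -> a = b.
Proof. intros [Ha Ha'] [Hb Hb']. apply Rle_antisym; auto. Qed.

Lemma box_vol_nonneg (d : nat) (B : pt * pt) : 0 <= box_vol d B.
Proof.
unfold box_vol. induction (seq 0 d) as [|i l IH]; simpl; [lra|].
apply Rmult_le_pos; [apply Rmax_l | exact IH].
Qed.

Lemma box_vol_scale (d : nat) (lam : R) (x : pt) (B : pt * pt) : 0 < lam ->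
  box_vol d (ptadd (ptscal lam (fst B)) x, ptadd (ptscal lam (snd B)) x) = lam ^ d * box_vol d B.
Proof.
intros Hl. unfold box_vol. rewrite <- (length_seq d 0) at 2.
induction (seq 0 d) as [|i l IH]; [simpl; ring|].
cbn [map fold_right length pow]. rewrite IH. cbn [fst snd]. unfold ptadd, ptscal.
replace (lam * snd B i + x i - (lam * fst B i + x i)) with (lam * (snd B i - fst B i)) by ring.
replace (Rmax 0 (lam * (snd B i - fst B i))) with (lam * Rmax 0 (snd B i - fst B i)).
- ring.
- rewrite <- (Rmult_0_r lam) at 2. symmetry. apply RmaxRmult. lra.
Qed.

Lemma box_cover_sums_mono (d : nat) (A A' : pt -> Prop) (s : R) :
  (forall y, A' y -> A y) -> box_cover_sums d A s -> box_cover_sums d A' s.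
Proof. intros H [Bs [H1 H2]]. exists Bs. split; auto. Qed.

Lemma box_cover_sums_homothet (d : nat) (A : pt -> Prop) (lam : R) (x : pt) (s : R) :
  0 < lam -> in_Rd d x -> box_cover_sums d A s ->
  box_cover_sums d (homothet lam x A) (lam ^ d * s).
Proof.
intros Hl Hx [Bs [H1 H2]].
exists (fun n => (ptadd (ptscal lam (fst (Bs n))) x, ptadd (ptscal lam (snd (Bs n))) x)).
split.
- intros y [k [Ak ->]]. destruct (H1 k Ak) as [n [Hk Hn]]. exists n. split.
  + intros i Hi. unfold ptadd, ptscal. rewrite (Hk i Hi), (Hx i Hi). ring.
  + intros i Hi. destruct (Hn i Hi) as [h1 h2]. unfold ptadd, ptscal; simpl.
    split; apply Rplus_le_compat_r; apply Rmult_le_compat_l; lra.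
- apply Un_cv_ext with (fun N => (fun _ => lam ^ d) N * sum_f_R0 (fun n => box_vol d (Bs n)) N).
  + intros N. rewrite scal_sum. apply sum_eq. intros i _.
    rewrite box_vol_scale by assumption. ring.
  + apply CV_mult; [|exact H2]. intros eps He. exists 0%nat. intros. unfold Rdist.
    rewrite Rminus_diag, Rabs_R0. exact He.
Qed.

Lemma homothet_inv (d : nat) (A : pt -> Prop) (lam : R) (x y : pt) : 0 < lam ->
  A y -> homothet (/ lam) (ptscal (- / lam) x) (homothet lam x A) y.
Proof.
intros Hl Ay. exists (ptadd (ptscal lam y) x). split; [exists y; auto|].
apply functional_extensionality. intros i. unfold ptadd, ptscal. field. lra.
Qed.

(** Scaling the covers by [lam] gives one inequality; scaling them back, by [homothet_inv], gives
    the other. *)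
Lemma is_vol_homothet (d : nat) (A : pt -> Prop) (lam : R) (x : pt) (v : R) :
  0 < lam -> in_Rd d x -> is_vol d A v -> is_vol d (homothet lam x A) (lam ^ d * v).
Proof.
intros Hl Hx [H1 H2]. assert (Hp : 0 < lam ^ d) by (apply pow_lt; lra).
assert (Hd : lam ^ d * / lam ^ d = 1) by (field; lra).
split.
- intros s Hs. apply (box_cover_sums_homothet d _ (/ lam) (ptscal (- / lam) x)) in Hs.
  + apply (box_cover_sums_mono _ _ A) in Hs; [|intros; apply homothet_inv; assumption].
    apply H1 in Hs. rewrite pow_inv in Hs.
    apply Rmult_le_compat_l with (r := lam ^ d) in Hs; [|lra].
    rewrite <- Rmult_assoc, Hd in Hs. lra.
  + apply Rinv_0_lt_compat; lra.
  + intros i Hi. unfold ptscal. rewrite (Hx i Hi). ring.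
- intros m Hm. assert (Hb : / lam ^ d * m <= v).
  { apply H2. intros s Hs. apply Rmult_le_reg_l with (lam ^ d); [lra|].
    rewrite <- Rmult_assoc, Hd, Rmult_1_l. apply Hm.
    apply box_cover_sums_homothet; assumption. }
  apply Rmult_le_compat_l with (r := lam ^ d) in Hb; [|lra].
  rewrite <- Rmult_assoc, Hd in Hb. lra.
Qed.

(** Two sequences of boxes are merged by the parity of the index; stopping at the odd index 2N + 1
    takes N + 1 terms from each. *)
Lemma sum_interleave (f g : nat -> R) (N : nat) :
  sum_f_R0 (fun n => if Nat.even n then f (Nat.div2 n) else g (Nat.div2 n)) (2 * N + 1) =
  sum_f_R0 f N + sum_f_R0 g N.
Proof.
induction N as [|N IH]; [simpl; ring|].
replace (2 * S N + 1)%nat with (S (S (2 * N + 1))) by lia.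
rewrite 2!tech5, IH.
replace (S (2 * N + 1)) with (2 * (S N))%nat by lia.
rewrite Nat.even_mul, Nat.div2_double. simpl (Nat.even 2 || _)%bool. cbv iota.
replace (S (2 * S N)) with (2 * S N + 1)%nat by lia.
rewrite Nat.even_add, Nat.even_mul, Nat.add_1_r, Nat.div2_succ_double.
simpl (Bool.eqb _ _). cbv iota. rewrite 2!tech5. ring.
Qed.

Lemma box_cover_sums_union (d : nat) (A A' : pt -> Prop) (s s' : R) :
  box_cover_sums d A s -> box_cover_sums d A' s' ->
  box_cover_sums d (fun y => A y \/ A' y) (s + s').
Proof.
intros [Bs [H1 H2]] [Bs' [H1' H2']].
exists (fun n => if Nat.even n then Bs (Nat.div2 n) else Bs' (Nat.div2 n)). split.
- intros y [Ay|Ay].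
  + destruct (H1 y Ay) as [n Hn]. exists (2 * n)%nat.
    rewrite Nat.even_mul, Nat.div2_double. exact Hn.
  + destruct (H1' y Ay) as [n Hn]. exists (2 * n + 1)%nat.
    rewrite Nat.even_add, Nat.even_mul, Nat.add_1_r, Nat.div2_succ_double. exact Hn.
- set (F := fun n => box_vol d (if Nat.even n then Bs (Nat.div2 n) else Bs' (Nat.div2 n))).
  assert (HF : forall N, sum_f_R0 F (2 * N + 1) =
    sum_f_R0 (fun n => box_vol d (Bs n)) N + sum_f_R0 (fun n => box_vol d (Bs' n)) N).
  { intros N. rewrite <- sum_interleave. apply sum_eq. intros i _. unfold F.
    destruct (Nat.even i); reflexivity. }
  pose proof (CV_plus _ _ _ _ H2 H2') as Hc.
  assert (mono : forall m n, (m <= n)%nat -> sum_f_R0 F m <= sum_f_R0 F n).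
  { intros m n Hmn. induction Hmn as [|n Hmn IH]; [lra|]. rewrite tech5.
    assert (0 <= F (S n)) by apply box_vol_nonneg. lra. }
  intros eps He. destruct (Hc eps He) as [N HN]. exists (2 * N + 1)%nat. intros n Hn.
  (* The index n lies between 2k + 1 and 2k + 3. The partial sums at both ends are near the limit,
     and partial sums are monotone. *)
  pose (k := Nat.div2 (n - 1)).
  assert (Hk : (N <= k)%nat /\ (2 * k + 1 <= n <= 2 * S k + 1)%nat).
  { unfold k. pose proof (Nat.div2_odd (n - 1)) as E.
    destruct (Nat.odd (n - 1)); simpl Nat.b2n in E; lia. }
  destruct Hk as [k1 [k2 k3]].
  pose proof (HN k ltac:(lia)) as a1. pose proof (HN (S k) ltac:(lia)) as a2.
  rewrite <- HF in a1, a2. unfold Rdist in *.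
  apply Rabs_def2 in a1. apply Rabs_def2 in a2. apply Rabs_def1;
  pose proof (mono _ _ k2); pose proof (mono _ _ k3); lra.
Qed.

(** Degenerate boxes pad a finite cover to a sequence. In dimension 0 the empty product would give
    them volume 1. *)
Lemma box_vol_empty (d : nat) : (1 <= d)%nat -> box_vol d (fun _ => 0, fun _ => 0) = 0.
Proof.
intros Hd. unfold box_vol. destruct d as [|d]; [lia|]. simpl.
rewrite Rminus_diag, Rmax_left by lra. ring.
Qed.

Lemma box_cover_sums_box (d : nat) (A : pt -> Prop) (B : pt * pt) : (1 <= d)%nat ->
  (forall y, A y -> in_box d B y) -> box_cover_sums d A (box_vol d B).
Proof.
intros Hd HA. exists (fun n => match n with O => B | S _ => (fun _ => 0, fun _ => 0) end). split.
- intros y Ay. exists 0%nat. auto.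
- intros eps He. exists 0%nat. intros n _.
  assert (E : sum_f_R0 (fun n => box_vol d (match n with O => B | S _ => (fun _ => 0, fun _ => 0) end)) n
    = box_vol d B).
  { induction n as [|n IH]; [reflexivity|]. rewrite tech5, IH, box_vol_empty by assumption. ring. }
  rewrite E. unfold Rdist. rewrite Rminus_diag, Rabs_R0. exact He.
Qed.

Lemma box_cover_sums_nonneg (d : nat) (A : pt -> Prop) (s : R) : box_cover_sums d A s -> 0 <= s.
Proof.
intros [Bs [_ H]]. apply Rle_cv_lim with (fun _ => 0) (fun N => sum_f_R0 (fun n => box_vol d (Bs n)) N).
- intros n. apply cond_pos_sum. intros; apply box_vol_nonneg.
- intros eps He. exists 0%nat. intros. unfold Rdist. rewrite Rminus_diag, Rabs_R0. exact He.
- exact H.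
Qed.

Lemma is_vol_exists (d : nat) (A : pt -> Prop) (s : R) : box_cover_sums d A s -> exists v, is_vol d A v.
Proof.
intros Hs. destruct (completeness (fun r => box_cover_sums d A (- r))) as [m [H1 H2]].
- exists 0. intros r Hr. apply box_cover_sums_nonneg in Hr. lra.
- exists (- s). rewrite Ropp_involutive. exact Hs.
- exists (- m). split.
  + intros r Hr. rewrite <- (Ropp_involutive r) in Hr. apply H1 in Hr. lra.
  + intros m' Hm'. assert (m <= - m'); [|lra]. apply H2. intros r Hr. apply Hm' in Hr. lra.
Qed.

Lemma is_glb_approx (S : R -> Prop) (m eps : R) : is_glb S m -> eps > 0 -> exists s, S s /\ s < m + eps.
Proof.
intros [_ H] He. apply NNPP. intros Hn.
assert (m + eps <= m); [|lra]. apply H. intros s Hs.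
apply Rnot_lt_le. intros Hl. apply Hn. exists s; auto.
Qed.

Lemma is_vol_union_list (d : nat) {I : Type} (C : I -> pt -> Prop) (eps : R) (l : list I) :
  (1 <= d)%nat -> (forall i, is_vol d (C i) 1) -> eps > 0 ->
  exists s, box_cover_sums d (fun y => exists i, In i l /\ C i y) s /\ s <= INR (length l) * (1 + eps).
Proof.
intros Hd HC He. induction l as [|i l [s [Hs Hle]]].
- exists 0. split; [|simpl; lra]. rewrite <- (box_vol_empty d Hd).
  apply box_cover_sums_box; [assumption|]. intros y [i [[] _]].
- destruct (is_glb_approx _ _ eps (HC i) He) as [s1 [Hs1 Hl1]].
  exists (s1 + s). split.
  + apply (box_cover_sums_mono _ (fun y => C i y \/ exists j, In j l /\ C j y)).
    * intros y [j [[->|Hj] Cj]]; [left; assumption | right; exists j; auto].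
    * apply box_cover_sums_union; assumption.
  + rewrite length_cons, S_INR. lra.
Qed.

Lemma sum_list_const {I : Type} (c : R) (l : list I) : sum_list (fun _ => c) l = INR (length l) * c.
Proof. induction l as [|i l IH]; [simpl; ring|]. rewrite length_cons, S_INR. simpl sum_list. rewrite IH. ring. Qed.

Lemma sqnorm_nonneg (d : nat) (y : pt) : 0 <= sqnorm d y.
Proof.
unfold sqnorm. induction (seq 0 d) as [|i l IH]; [simpl; lra|].
simpl map. simpl fold_right. pose proof (pow2_ge_0 (y i)). simpl in *. lra.
Qed.

(** Young's inequality in each coordinate. A small [tau] keeps the factor of the large vector [y]
    near 1, at the cost of the bounded vector [w]. *)
Lemma sqnorm_add_le (d : nat) (y w : pt) (tau : R) : 0 < tau ->
  sqnorm d (ptadd y w) <= (1 + tau) * sqnorm d y + (1 + / tau) * sqnorm d w.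
Proof.
intros Ht. unfold sqnorm. induction (seq 0 d) as [|i l IH]; [simpl; lra|].
simpl map. simpl fold_right.
assert (ptadd y w i ^ 2 <= (1 + tau) * y i ^ 2 + (1 + / tau) * w i ^ 2).
{ unfold ptadd. replace ((1 + tau) * y i ^ 2 + (1 + / tau) * w i ^ 2) with
    ((y i + w i) ^ 2 + / tau * (tau * y i - w i) ^ 2) by (field; lra).
  pose proof (pow2_ge_0 (tau * y i - w i)). pose proof (Rinv_0_lt_compat tau Ht).
  pose proof (Rmult_le_pos _ _ (Rlt_le _ _ H0) H). lra. }
simpl in *. lra.
Qed.

Lemma sqnorm_le (d : nat) (w : pt) (M : R) : (forall i, (i < d)%nat -> Rabs (w i) <= M) ->
  sqnorm d w <= INR d * M ^ 2.
Proof.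
intros H. unfold sqnorm. rewrite <- (length_seq d 0) at 2.
assert (H' : forall i, In i (seq 0 d) -> Rabs (w i) <= M).
{ intros i Hi. apply in_seq in Hi. apply H. lia. }
revert H'. induction (seq 0 d) as [|i l IH]; intros H'; [simpl; lra|].
rewrite length_cons, S_INR. cbn [map fold_right].
assert (w i ^ 2 <= M ^ 2).
{ rewrite <- (pow2_abs (w i)). apply pow_incr. split; [apply Rabs_pos | apply H'; left; reflexivity]. }
pose proof (IH (fun j Hj => H' j (or_intror Hj))). lra.
Qed.

Lemma dist_lt_of_coordinates (d : nat) (x y : pt) (r : R) : (1 <= d)%nat -> 0 < r ->
  (forall i, (i < d)%nat -> Rabs (x i - y i) <= r / (2 * INR d)) -> Defs.dist d x y < r.
Proof.
intros Hd Hr H. apply sqnorm_le in H. unfold Defs.dist.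
assert (Hdr : 1 <= INR d) by (replace 1 with (INR 1) by reflexivity; apply le_INR; lia).
rewrite <- (sqrt_pow2 r ltac:(lra)). apply sqrt_lt_1_alt. split; [apply sqnorm_nonneg|].
apply Rle_lt_trans with (1 := H).
replace (INR d * (r / (2 * INR d)) ^ 2) with (r ^ 2 * / (4 * INR d)) by (field; lra).
rewrite <- (Rmult_1_r (r ^ 2)) at 2. apply Rmult_lt_compat_l; [apply pow_lt; lra|].
rewrite <- Rinv_1. apply Rinv_lt_contravar; lra.
Qed.

Lemma ball_sqnorm (d : nat) (r : R) (y : pt) : 0 <= r ->
  (ball d r y <-> in_Rd d y /\ sqnorm d y <= r ^ 2).
Proof.
intros Hr. unfold ball. pose proof (sqnorm_nonneg d y) as Hn. split; intros [H1 H2]; split; auto.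
- rewrite <- (sqrt_sqrt _ Hn). pose proof (sqrt_pos (sqnorm d y)). simpl. rewrite Rmult_1_r.
  apply Rmult_le_compat; lra.
- rewrite <- (sqrt_pow2 r Hr). apply sqrt_le_1_alt. exact H2.
Qed.

Lemma ball_box_cover (d : nat) (r : R) : (1 <= d)%nat -> 0 <= r -> exists s, box_cover_sums d (ball d r) s.
Proof.
intros Hd Hr. exists (box_vol d (fun _ => - r, fun _ => r)). apply box_cover_sums_box; [assumption|].
intros y Hy. apply (ball_sqnorm d r y Hr) in Hy. destruct Hy as [H1 H2]. split; [assumption|].
intros i Hi. simpl.
assert (y i ^ 2 <= sqnorm d y).
{ assert (Hin : In i (seq 0 d)) by (apply in_seq; lia). unfold sqnorm. clear H2.
  induction (seq 0 d) as [|j l IH]; [destruct Hin|].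
  assert (0 <= fold_right Rplus 0 (map (fun i => y i ^ 2) l)).
  { clear. induction l as [|j l IH]; [simpl; lra|]. simpl map. simpl fold_right.
    pose proof (pow2_ge_0 (y j)). simpl in *. lra. }
  simpl map. simpl fold_right. destruct Hin as [->|Hin]; [simpl in *; lra|].
  apply IH in Hin. pose proof (pow2_ge_0 (y j)). simpl in *. lra. }
assert (Ha : Rabs (y i) <= r).
{ rewrite <- (Rabs_pos_eq r Hr). apply Rsqr_le_abs_0. rewrite !Rsqr_pow2. lra. }
pose proof (Rle_abs (y i)). pose proof (Rle_abs (- y i)). rewrite Rabs_Ropp in *. lra.
Qed.

Lemma ball_homothet (d : nat) (r beta : R) (y : pt) : 0 <= r -> 0 < beta ->
  (ball d (beta * r) y <-> homothet beta (fun _ => 0) (ball d r) y).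
Proof.
intros Hr Hb.
assert (E : forall z, sqnorm d (ptscal beta z) = beta ^ 2 * sqnorm d z).
{ intros z. unfold sqnorm. induction (seq 0 d) as [|i l IH]; [simpl; ring|].
  cbn [map fold_right]. rewrite IH. unfold ptscal. ring. }
assert (Hb2 : 0 < beta ^ 2) by (apply pow_lt; assumption).
split.
- intros Hy. apply ball_sqnorm in Hy; [|apply Rmult_le_pos; lra]. destruct Hy as [H1 H2].
  assert (Ey : y = ptscal beta (ptscal (/ beta) y)).
  { apply functional_extensionality. intros i. unfold ptscal. field. lra. }
  exists (ptscal (/ beta) y). split.
  + apply ball_sqnorm; [assumption|]. split.
    * intros i Hi. unfold ptscal. rewrite (H1 i Hi). ring.
    * rewrite Ey, E in H2. apply Rmult_le_reg_l with (beta ^ 2); [assumption|].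
      replace (beta ^ 2 * r ^ 2) with ((beta * r) ^ 2) by ring. exact H2.
  + apply functional_extensionality. intros i. unfold ptadd, ptscal. field. lra.
- intros [k [Hk ->]]. apply ball_sqnorm in Hk; [|assumption]. destruct Hk as [H1 H2].
  replace (ptadd (ptscal beta k) (fun _ => 0)) with (ptscal beta k)
    by (apply functional_extensionality; intros i; unfold ptadd; ring).
  apply ball_sqnorm; [apply Rmult_le_pos; lra|]. split.
  + intros i Hi. unfold ptscal. rewrite (H1 i Hi). ring.
  + rewrite E. replace ((beta * r) ^ 2) with (beta ^ 2 * r ^ 2) by ring.
    apply Rmult_le_compat_l; lra.
Qed.

Lemma is_vol_ext (d : nat) (A A' : pt -> Prop) (v : R) : (forall y, A y <-> A' y) ->
  is_vol d A v -> is_vol d A' v.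
Proof.
intros E [H1 H2]. split.
- intros s Hs. apply H1. apply (box_cover_sums_mono _ A'); [apply E | exact Hs].
- intros m Hm. apply H2. intros s Hs. apply Hm.
  apply (box_cover_sums_mono _ A); [apply E | exact Hs].
Qed.

Lemma is_vol_translate (d : nat) (A : pt -> Prop) (x : pt) (v : R) : in_Rd d x ->
  is_vol d A v -> is_vol d (translate x A) v.
Proof.
intros Hx H. apply (is_vol_ext _ (homothet 1 x A)).
- intros y. unfold translate, homothet. split.
  + intros [k [Hk ->]]. replace (ptsub _ x) with k; [exact Hk|].
    apply functional_extensionality. intros i. unfold ptsub, ptadd, ptscal. ring.
  + intros Hk. exists (ptsub y x). split; [exact Hk|].
    apply functional_extensionality. intros i. unfold ptsub, ptadd, ptscal. ring.
- pose proof (is_vol_homothet d A 1 x v ltac:(lra) Hx H) as E.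
  rewrite pow1, Rmult_1_l in E. exact E.
Qed.

(** A list of elements of [P] that misses one of them can be extended, and the length bound [N]
    stops this process. *)
Lemma maximal_list {I : Type} (P : I -> Prop) (N : nat) :
  (forall l, NoDup l -> (forall i, In i l -> P i) -> (length l <= N)%nat) ->
  exists l, NoDup l /\ (forall i, In i l <-> P i).
Proof.
intros H.
assert (G : forall n l, NoDup l -> (forall i, In i l -> P i) -> (N <= length l + n)%nat ->
  exists l', NoDup l' /\ (forall i, In i l' <-> P i)).
{ induction n as [|n IH]; intros l Hl Hp Hn;
  (destruct (classic (exists i, P i /\ ~ In i l)) as [[i [Pi Hi]]|Hc];
   [assert (NoDup (i :: l)) by (constructor; assumption);
    assert (Hp' : forall j, In j (i :: l) -> P j) by (intros j [->|Hj]; auto)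
   |exists l; split; [assumption|]; intros i; split; [apply Hp|];
    intros Pi; apply NNPP; intros Hi; apply Hc; exists i; auto]).
  - pose proof (H _ H0 Hp'). rewrite length_cons in *. lia.
  - apply (IH (i :: l)); auto. rewrite length_cons. lia. }
apply (G N nil); [constructor | intros i [] | simpl; lia].
Qed.

Lemma bernoulli_sub (x : R) (n : nat) : 0 <= x <= 1 -> 1 - INR n * x <= (1 - x) ^ n.
Proof.
intros Hx. induction n as [|n IH]; [simpl; lra|]. rewrite S_INR, <- tech_pow_Rmult.
apply Rle_trans with ((1 - x) * (1 - INR n * x)); [|apply Rmult_le_compat_l; lra].
pose proof (pos_INR n). nra.
Qed.

(* The translates inside [ball r] are finitely many because the density is finite, and they cover
   [ball (beta * r)] for any fixed [beta < 1] once [r] is large. *)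
Lemma covering_density_ge1 (d : nat) (K : pt -> Prop) (t : R) : (1 <= d)%nat ->
  convex_body d K -> is_vol d K 1 -> covering_density_values d K t -> 1 <= t.
Proof.
intros Hd [HKd [_ [[M0 HM0] _]]] HK [I [x [Hx [Hcov Hden]]]].
pose (M := Rabs M0 + 1).
assert (HM1 : 1 <= M) by (unfold M; pose proof (Rabs_pos M0); lra).
assert (HM : forall k, K k -> forall i, Rabs (k i) <= M).
{ intros k Hk i. pose proof (HM0 k Hk i). pose proof (Rle_abs M0). unfold M. lra. }
apply Rnot_lt_le. intros Ht.
(* With t = 1 - 3 eps the final contradiction is (t + eps)(1 + eps) = (1 - 2 eps)(1 + eps) < 1 -
   eps/2 <= beta^d. *)
pose (eps := (1 - t) / 3). assert (He : eps > 0) by (unfold eps; lra).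
destruct (Hden eps He) as [R0 HR0].
assert (Hdr : 1 <= INR d) by (replace 1 with (INR 1) by reflexivity; apply le_INR; lia).
pose (x0 := Rmin (eps / (2 * INR d)) (1 / 2)).
assert (Hx0 : 0 < x0) by (apply Rmin_pos; [apply Rdiv_lt_0_compat; lra | lra]).
assert (Hx1 : x0 <= 1 / 2) by apply Rmin_r.
assert (Hx2 : INR d * x0 <= eps / 2).
{ apply Rle_trans with (INR d * (eps / (2 * INR d))).
  - apply Rmult_le_compat_l; [lra | apply Rmin_l].
  - right. field. lra. }
pose (beta := 1 - x0).
assert (Hbd : 1 - eps / 2 <= beta ^ d) by (pose proof (bernoulli_sub x0 d ltac:(lra)); unfold beta; lra).
pose (W := INR d * (2 * M) ^ 2).
assert (HW : 0 <= W) by (apply Rmult_le_pos; [lra | apply pow2_ge_0]).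
(* [W] bounds the squared distance of two points of one translate. For r >= Q its contribution in
   [sqnorm_add_le] is at most x0 r^2, which is what the shrinking to [beta * r] leaves free. The
   bound r >= d M^2 below puts K itself into the ball, so that [vb] is at least 1. *)
pose (Q := (1 + / x0) * W / x0).
pose (r := Rmax R0 (Rmax 1 (Rmax Q (INR d * M ^ 2)))).
assert (Hr0 : R0 <= r) by apply Rmax_l.
assert (Hr1 : 1 <= r) by (eapply Rle_trans; [|apply Rmax_r]; apply Rmax_l).
assert (HrQ : Q <= r).
{ do 2 (eapply Rle_trans; [|apply Rmax_r]). apply Rmax_l. }
assert (HrM : INR d * M ^ 2 <= r).
{ do 2 (eapply Rle_trans; [|apply Rmax_r]). apply Rmax_r. }
assert (Hr2 : r <= r ^ 2) by nra.
destruct (ball_box_cover d r Hd ltac:(lra)) as [s0 Hs0].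
destruct (is_vol_exists _ _ _ Hs0) as [vb Hvb].
assert (Hvb1 : 1 <= vb).
{ apply Hvb. intros s Hs. apply HK. apply (box_cover_sums_mono _ (ball d r)); [|exact Hs].
  intros k Hk. apply ball_sqnorm; [lra|]. split; [auto|].
  pose proof (sqnorm_le d k M (fun i _ => HM k Hk i)). lra. }
assert (Hlen : forall l, NoDup l -> (forall i, In i l -> forall y, translate (x i) K y -> ball d r y) ->
  INR (length l) <= (t + eps) * vb).
{ intros l Hl Hin. rewrite <- (Rmult_1_r (INR (length l))), <- (sum_list_const 1 l).
  apply (HR0 r ltac:(lra) (fun _ => 1) vb); auto.
  intros i. apply is_vol_translate; auto. }
destruct (INR_unbounded ((t + eps) * vb)) as [N HN].
destruct (maximal_list (fun i => forall y, translate (x i) K y -> ball d r y) N) as [l [Hl Hmax]].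
{ intros l Hl Hin. apply INR_le. pose proof (Hlen l Hl Hin). lra. }
pose proof (Hlen l Hl (fun i => proj1 (Hmax i))) as Hll.
destruct (is_vol_union_list d (fun i => translate (x i) K) eps l Hd
  (fun i => is_vol_translate _ _ _ _ (Hx i) HK) He) as [s [Hs Hsl]].
(* A translate that meets the smaller ball lies inside [ball d r], hence occurs in the complete list
   [l]. *)
assert (Hsub : box_cover_sums d (ball d (beta * r)) s).
{ apply (box_cover_sums_mono _ (fun y => exists i, In i l /\ translate (x i) K y)); [|exact Hs].
  intros y Hy. apply ball_sqnorm in Hy; [|unfold beta; nra]. destruct Hy as [Hy1 Hy2].
  destruct (Hcov y Hy1) as [i Hi]. exists i. split; [|exact Hi]. apply Hmax.
  intros z Hz. apply ball_sqnorm; [lra|]. split.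
  - intros j Hj. pose proof (HKd _ Hz j Hj) as E. unfold ptsub in E. rewrite (Hx i j Hj) in E. lra.
  - replace z with (ptadd y (ptsub z y))
      by (apply functional_extensionality; intros j; unfold ptadd, ptsub; ring).
    eapply Rle_trans; [apply (sqnorm_add_le d y (ptsub z y) x0 Hx0)|].
    assert (HzW : sqnorm d (ptsub z y) <= W).
    { apply sqnorm_le. intros j _. unfold translate in *.
      replace (ptsub z y j) with (ptsub z (x i) j + - ptsub y (x i) j) by (unfold ptsub; ring).
      eapply Rle_trans; [apply Rabs_triang|]. rewrite Rabs_Ropp.
      pose proof (HM _ Hz j). pose proof (HM _ Hi j). lra. }
    assert (Hi0 : 0 < / x0) by (apply Rinv_0_lt_compat; lra).
    assert (A1 : (1 + x0) * sqnorm d y <= (1 - x0) * r ^ 2).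
    { apply Rle_trans with ((1 + x0) * (beta * r) ^ 2); [apply Rmult_le_compat_l; lra|].
      unfold beta. replace ((1 + x0) * ((1 - x0) * r) ^ 2)
        with ((1 - x0) * r ^ 2 * (1 - x0 ^ 2)) by ring.
      rewrite <- (Rmult_1_r ((1 - x0) * r ^ 2)) at 2. apply Rmult_le_compat_l; nra. }
    assert (A2 : (1 + / x0) * sqnorm d (ptsub z y) <= x0 * r ^ 2).
    { apply Rle_trans with ((1 + / x0) * W); [apply Rmult_le_compat_l; lra|].
      replace ((1 + / x0) * W) with (x0 * Q) by (unfold Q; field; lra).
      apply Rmult_le_compat_l; lra. }
    lra. }
assert (Hvol : is_vol d (ball d (beta * r)) (beta ^ d * vb)).
{ apply (is_vol_ext _ (homothet beta (fun _ => 0) (ball d r))).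
  - intros y. symmetry. apply ball_homothet; unfold beta; lra.
  - apply is_vol_homothet; [unfold beta; lra | intros i _; reflexivity | exact Hvb]. }
destruct Hvol as [Hv _]. apply Hv in Hsub.
pose proof (pos_INR (length l)) as Hpos.
assert (B1 : INR (length l) * (1 + eps) <= (t + eps) * vb * (1 + eps)).
{ apply Rmult_le_compat_r; lra. }
assert (B2 : (1 - eps / 2) * vb <= beta ^ d * vb) by (apply Rmult_le_compat_r; lra).
assert (B3 : (t + eps) * (1 + eps) < 1 - eps / 2) by (unfold eps in *; nra).
assert (B4 : (t + eps) * (1 + eps) * vb < (1 - eps / 2) * vb) by (apply Rmult_lt_compat_r; lra).
lra.
Qed.

Lemma theta_ge1 (d : nat) (K : pt -> Prop) (th : R) : (1 <= d)%nat ->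
  convex_body d K -> is_vol d K 1 -> is_theta d K th -> 1 <= th.
Proof.
intros Hd HK Hv [_ H]. apply H. intros t. apply covering_density_ge1; assumption.
Qed.

(** * Finite subfamilies and numerical inequalities *)

Lemma sum_list_ext {I : Type} (f g : I -> R) (l : list I) : (forall i, f i = g i) ->
  sum_list f l = sum_list g l.
Proof. intros E. induction l as [|i l IH]; simpl; [reflexivity | rewrite E, IH; reflexivity]. Qed.

(** As K has volume 1, the volume of a homothet is [lam i ^ d]. The total volume is a supremum over
    finite lists, hence the loss [eps]. *)
Lemma total_vol_homothets (d : nat) (K : pt -> Prop) {I : Type} (lam : I -> R) (x : I -> pt) (T eps : R) :
  is_vol d K 1 -> (forall i, lam i > 0) -> (forall i, in_Rd d (x i)) -> eps > 0 ->
  total_vol_ge d (fun i => homothet (lam i) (x i) K) T ->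
  exists l, NoDup l /\ T - eps <= sum_list (fun i => lam i ^ d) l.
Proof.
intros HK Hl Hx He [v [Hv H]]. destruct (H eps He) as [l [H1 H2]]. exists l. split; [assumption|].
rewrite (sum_list_ext _ v); [lra|]. intros i.
pose proof (is_vol_homothet d K (lam i) (x i) 1 ltac:(pose proof (Hl i); lra) (Hx i) HK) as E.
rewrite Rmult_1_r in E. apply (is_glb_unique _ _ _ E (Hv i)).
Qed.

(** Turns a choice made for positions in a list into one made for the indices themselves; without
    repetitions no index receives two values. *)
Lemma list_assign {I A : Type} (a0 : A) (l : list I) (g : nat -> A) : NoDup l ->
  exists t : I -> A, forall n i, nth_error l n = Some i -> t i = g n.
Proof.
revert g. induction l as [|a l IH]; intros g Hl.
- exists (fun _ => a0). intros [|n] i; discriminate.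
- inversion Hl as [|? ? Ha Hl']; subst. destruct (IH (fun n => g (S n)) Hl') as [t Ht].
  exists (fun i => if excluded_middle_informative (i = a) then g 0%nat else t i).
  intros [|n] i Hi; simpl in Hi.
  + injection Hi as <-. destruct (excluded_middle_informative (a = a)); congruence.
  + destruct (excluded_middle_informative (i = a)) as [->|_]; [|apply Ht; exact Hi].
    apply nth_error_In in Hi. contradiction.
Qed.

(** The case d = 3 is tight: the left side is about 222.5, and the right side is at least 8 (27 + 2)
    - 1 = 231. The factor 101/100 is the slack of the almost maximal basis. *)
Lemma numeric_small (d : nat) (c : R) : (1 <= d <= 3)%nat -> 2 ^ d <= c ->
  (2 * (INR d * (101 / 100))) ^ d <= c * (INR d ^ 3 * ln (INR d) + exp 1) - 1.
Proof.
intros Hd Hc.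
assert (He : 2 <= exp 1) by (pose proof (exp_ineq1 1 ltac:(lra)); lra).
assert (Hc0 : 0 <= c) by (pose proof (pow_lt 2 d ltac:(lra)); lra).
assert (Hce : c * 2 <= c * exp 1) by (apply Rmult_le_compat_l; lra).
destruct d as [|[|[|[|d]]]]; try lia; simpl INR; simpl pow in *.
- rewrite ln_1. lra.
- assert (Hl : / 2 < ln (1 + 1)) by (replace (1 + 1) with 2 by ring; apply ln_lt_2).
  assert (Hcl : c * / 2 <= c * ln (1 + 1)) by (apply Rmult_le_compat_l; lra). lra.
- assert (Hl : 1 <= ln (1 + 1 + 1)).
  { apply Rle_trans with (ln (exp 1)); [rewrite ln_exp; lra|]. pose proof exp_le_3. pose proof (exp_pos 1).
    destruct (Rle_lt_or_eq_dec (exp 1) (1 + 1 + 1) ltac:(lra)) as [Hlt|E].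
    - left. apply ln_increasing; lra.
    - rewrite E. apply Rle_refl. }
  assert (Hcl : c * 1 <= c * ln (1 + 1 + 1)) by (apply Rmult_le_compat_l; lra). lra.
Qed.

(** Here d^2 >= 16 exceeds 15, and c e >= 4 pays for the additive constants. *)
Lemma numeric_large (d : nat) (c : R) : (4 <= d)%nat -> 2 ^ d <= c ->
  15 * c * INR d * ln (INR d) + 2 <= c * (INR d ^ 3 * ln (INR d) + exp 1) - 1.
Proof.
intros Hd Hc.
assert (He : 2 <= exp 1) by (pose proof (exp_ineq1 1 ltac:(lra)); lra).
assert (H4 : 4 <= INR d) by (replace 4 with (INR 4) by (simpl; ring); apply le_INR; lia).
assert (Hl : 0 <= ln (INR d)) by (rewrite <- ln_1; left; apply ln_increasing; lra).
assert (H2 : 2 ^ 1 <= 2 ^ d) by (apply Rle_pow; [lra | lia]).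
assert (Hp : 0 <= c * (INR d * ln (INR d))).
{ apply Rmult_le_pos; [lra|]. apply Rmult_le_pos; lra. }
assert (Hq : 0 <= c * (INR d * ln (INR d)) * (INR d ^ 2 - 15)) by (apply Rmult_le_pos; nra).
replace (c * (INR d ^ 3 * ln (INR d) + exp 1) - 1) with
  (c * (INR d * ln (INR d)) * (INR d ^ 2 - 15) + 15 * c * INR d * ln (INR d) + c * exp 1 - 1) by ring.
nra.
Qed.

Module LatticeCounting.
From mathcomp Require Import all_boot all_order perm all_algebra finmap.
From mathcomp Require Import boolp classical_sets functions cardinality reals sequences exp.
From mathcomp Require Import zify ring lra.
Set Implicit Arguments. Unset Strict Implicit. Unset Printing Implicit Defensive.
Import Order.TTheory GRing.Theory Num.Theory.
Local Open Scope ring_scope.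

(** * Lattice points in convex sets *)

Lemma euclid_unique (a b : int) (k p q : nat) : (p < k)%N -> (q < k)%N ->
  a * k%:Z + p%:Z = b * k%:Z + q%:Z -> a = b /\ p%:Z = q%:Z.
Proof.
move=> pk qk.
have mono (x y : int) : x < y -> x * k%:Z + k%:Z <= y * k%:Z.
  move=> xy; have -> : x * k%:Z + k%:Z = (x + 1) * k%:Z by rewrite mulrDl mul1r.
  by apply: ler_wpM2r => //; lia.
by case: (ltrgtP a b) => [/mono|/mono|->]; move: (_ * _) => u; try move: (_ * _) => w; lia.
Qed.

Section Lattice.
Variables (R : realType) (d : nat).
Implicit Types (A B K : set 'rV[R]_d) (x y t : 'rV[R]_d) (z w : 'rV[int]_d).

Definition zr z : 'rV[R]_d := map_mx intr z.

(* [s *: A + t], for [s > 0]. *)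
Definition scaled (s : R) A t : set 'rV[R]_d := [set x | A (s^-1 *: (x - t))].

Definition spread (L : R) A := forall x y, A x -> A y -> forall i, `|x 0 i - y 0 i| <= L.

Definition convex A := forall x y (s : R), A x -> A y -> 0 <= s <= 1 ->
  A (s *: x + (1 - s) *: y).

Definition cube_in A := forall x, (forall i, `|x 0 i| <= 2^-1) -> A x.

(** [fset_set] sends an infinite set to the empty one, so this is meaningful only for bounded
    [A]. *)
Definition lat A : {fset 'rV[int]_d} := fset_set [set z | A (zr z)].

Definition offset n (j : 'rV['I_n]_d) : 'rV[int]_d := map_mx (fun i : 'I_n => (i : nat)%:Z) j.

Lemma offset_inj n : injective (@offset n).
Proof.
move=> i j /rowP e; apply/rowP => l; have := e l; rewrite !mxE => -[e'].
exact: val_inj.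
Qed.

Lemma card_rV_ord n : #|{: 'rV['I_n]_d}| = (n ^ d)%N.
Proof. by rewrite card_mx card_ord mul1n. Qed.

Lemma lat_finite_card (Z : set 'rV[int]_d) (N : nat) :
  (forall z w, Z z -> Z w -> forall i, `|z 0 i - w 0 i| <= N%:Z) ->
  finite_set Z /\ (#|` fset_set Z| <= N.*2.+1 ^ d)%N.
Proof.
move=> hZ; have [->|/set0P [z0 Zz0]] := eqVneq Z set0.
  by split=> //; rewrite fset_set0 cardfs0.
pose f (j : 'rV['I_(N.*2.+1)]_d) := z0 + offset j - const_mx N%:Z.
have sub : (Z `<=` f @` setT)%classic.
  move=> z Zz; exists (\row_i inord `|(z 0 i - z0 0 i + N%:Z)%R|%N) => //.
  apply/rowP => i; rewrite !mxE; have := hZ _ _ Zz Zz0 i.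
  move: (z 0 i) (z0 0 i) => a b hab.
  rewrite inordK; lia.
have fin : finite_set (f @` setT)%classic by exact: finite_image.
have finZ : finite_set Z by exact: sub_finite_set sub fin.
split=> //; rewrite -card_rV_ord.
pose S := [fset f j | j in {: 'rV['I_(N.*2.+1)]_d}]%fset.
have : (fset_set Z `<=` S)%fset.
  apply/fsubsetP => z; rewrite in_fset_set // inE => /sub [j _ <-].
  by apply/imfsetP; exists j.
move=> /fsubset_leq_card h; apply: leq_trans h _.
by apply: leq_trans (leq_imfset_card _ _ _) _; rewrite /= cardE.
Qed.

Lemma spread_lat L A : 0 <= L -> spread L A ->
  finite_set [set z | A (zr z)]%classic /\ #|` lat A|%:R <= (2 * L + 1) ^+ d.
Proof.
move=> L0 hA.
have [|fin h] := @lat_finite_card [set z | A (zr z)] (Num.truncn L).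
  move=> z w /= Az Aw i; have := hA _ _ Az Aw i; rewrite !mxE.
  rewrite -intrB -intr_norm => h.
  have h0 : 0 <= `|z 0 i - w 0 i| by [].
  rewrite -(gez0_abs h0) lez_nat -ltnS.
  rewrite -(ltr_nat R); apply: le_lt_trans (truncnS_gt L).
  by apply: le_trans h; rewrite -pmulrn.
split=> //; apply: (@le_trans _ _ ((Num.truncn L).*2.+1 ^ d)%N%:R).
  by rewrite ler_nat.
rewrite natrX; apply: lerXn2r; rewrite ?nnegrE ?ler0n//; first by lra.
by rewrite -addn1 -mul2n natrD natrM lerD2r ler_pM2l ?ltr0n// truncn_le.
Qed.

Lemma in_lat L A z : 0 <= L -> spread L A -> (z \in lat A) = `[< A (zr z) >].
Proof.
move=> L0 hA; have [fin _] := spread_lat L0 hA.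
by rewrite in_fset_set //; apply/idP/asboolP => [/set_mem|/mem_set].
Qed.

(** By uniqueness of Euclidean division in each coordinate, the boxes kz + [0, k)^d + v for distinct
    z are disjoint. *)
Lemma card_subdiv (W X : seq 'rV[int]_d) (k : nat) (v : 'rV[int]_d) : uniq W ->
  (forall z (j : 'rV['I_k]_d), z \in W -> z *+ k + offset j + v \in X) ->
  (size W * k ^ d <= size X)%N.
Proof.
move=> uW h.
pose f z (j : 'rV['I_k]_d) := z *+ k + offset j + v.
have finj z j z' j' : f z j = f z' j' -> (z, j) = (z', j').
  move=> /rowP e.
  have key i : z 0 i = z' 0 i /\ offset j 0 i = offset j' 0 i.
    have := e i; rewrite /f !mxE !mulmxnE -[z 0 i *+ k]mulr_natr -[z' 0 i *+ k]mulr_natr !natz => {}e.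
    have lj := ltn_ord (j 0 i); have lj' := ltn_ord (j' 0 i).
    move: e => /addIr; exact: euclid_unique.
  congr pair; first by apply/rowP => i; case: (key i).
  by apply: offset_inj; apply/rowP => i; case: (key i).
have <- : size [seq f z j | z <- W, j <- enum {: 'rV['I_k]_d}] = (size W * k ^ d)%N.
  by rewrite size_allpairs -card_rV_ord cardE.
apply: uniq_leq_size.
  apply: allpairs_uniq; rewrite ?enum_uniq//.
  by move=> [z j] [z' j'] _ _; apply: finj.
by move=> _ /allpairsP [[z j] /= [zW _ ->]]; apply: h.
Qed.
End Lattice.

(** * Asymptotic density of lattice points *)

Lemma bernoulli (R : realType) (x : R) (n : nat) : 0 <= x <= 1 -> 1 - n%:R * x <= (1 - x) ^+ n.
Proof.
move=> /andP [x0 x1]; elim: n => [|n IH]; first by rewrite mul0r subr0 expr0.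
rewrite exprS; have : (1 - x) * (1 - n%:R * x) <= (1 - x) * (1 - x) ^+ n.
  by apply: ler_wpM2l => //; lra.
apply: le_trans; rewrite -natr1.
have : 0 <= n%:R * x * x by rewrite !mulr_ge0.
lra.
Qed.

(** Bernoulli's inequality for a/(s + a) and a/s; the threshold makes n a (1 + e) <= e s. *)
Lemma pow_near (R : realType) (n : nat) (a e : R) : 0 <= a -> 0 < e ->
  exists2 S : R, 0 < S & forall s, S <= s ->
    [/\ a < s, (s + a) ^+ n <= (1 + e) * s ^+ n & (1 - e) * s ^+ n <= (s - a) ^+ n].
Proof.
move=> a0 e0.
exists (a + 1 + n%:R * a * (1 + e) / e) => [|s].
  rewrite ltr_wpDr //; last by lra.
  by rewrite !mulr_ge0 // ?invr_ge0; lra.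
have q0 : 0 <= n%:R * a * (1 + e) / e by rewrite !mulr_ge0 // ?invr_ge0; lra.
move=> hs; have s0 : 0 < s by lra.
have h1 : n%:R * a * (1 + e) <= e * s.
  by rewrite [e * s]mulrC -ler_pdivrMr //; lra.
have na0 : 0 <= n%:R * a by rewrite mulr_ge0.
have h2 : n%:R * (a / s) <= e.
  rewrite mulrA ler_pdivrMr //; have : 0 <= n%:R * a * e by rewrite mulr_ge0 // ltW.
  lra.
split; first by lra.
- have sa : 0 < s + a by lra.
  have : (1 - n%:R * (a / (s + a))) * (s + a) ^+ n <= s ^+ n.
    have -> : s = (1 - a / (s + a)) * (s + a) by field; rewrite gt_eqF.
    have -> : (1 - a / (s + a)) * (s + a) + a = s + a by field; rewrite gt_eqF.
    rewrite exprMn; apply: ler_wpM2r; first by rewrite exprn_ge0 // ltW.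
    apply: bernoulli; rewrite divr_ge0 //=; last by lra.
    by rewrite ler_pdivrMr // mul1r; lra.
  have h3 : (1 + e)^-1 <= 1 - n%:R * (a / (s + a)).
    have h4 : n%:R * (a / (s + a)) <= e / (1 + e).
      rewrite mulrA ler_pdivrMr // mulrAC ler_pdivlMr; last by lra.
      have : 0 <= e * a by rewrite mulr_ge0 // ltW.
      lra.
    have -> : (1 + e)^-1 = 1 - e / (1 + e) by field; lra.
    lra.
  have p0 : 0 <= (s + a) ^+ n by rewrite exprn_ge0 // ltW.
  move=> h; have h5 : (1 + e)^-1 * (s + a) ^+ n <= s ^+ n.
    by apply: le_trans h; apply: ler_wpM2r.
  by rewrite -ler_pdivrMl //; lra.
- have -> : s - a = (1 - a / s) * s by field; rewrite gt_eqF.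
  rewrite exprMn; apply: ler_wpM2r; first by rewrite exprn_ge0 // ltW.
  apply: le_trans (bernoulli _ _); first by lra.
  by rewrite divr_ge0 //= ?ler_pdivrMr //; lra.
Qed.

Section Counting.
Variables (R : realType) (d : nat).
Implicit Types (A B K : set 'rV[R]_d) (x y t : 'rV[R]_d) (z w : 'rV[int]_d).

(** A convex combination with weights s/(s + r) and r/(s + r): the Minkowski sum of sA and rA lies
    in (s + r)A. *)
Lemma scaled_add A (s r : R) t u x y : convex A -> 0 < s -> 0 < r ->
  scaled s A t x -> scaled r A u y -> scaled (s + r) A (t + u) (x + y).
Proof.
move=> cA s0 r0 hx hy; rewrite /scaled /=.
have sr : s + r != 0 by rewrite gt_eqF // addr_gt0.
have := cA _ _ (s / (s + r)) hx hy; rewrite !scalerA.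
have -> : s / (s + r) * s^-1 = (s + r)^-1 by field; rewrite sr gt_eqF.
have -> : (1 - s / (s + r)) * r^-1 = (s + r)^-1 by field; rewrite sr gt_eqF.
rewrite -scalerDr opprD addrACA; apply.
have sr0 : 0 < s + r by rewrite addr_gt0.
by rewrite ler_pdivrMr // mul1r lerDl (ltW r0) divr_ge0 // ltW.
Qed.

Lemma scaled_cube A (r : R) t x : cube_in A -> 0 < r ->
  (forall i, `|x 0 i - t 0 i| <= r / 2) -> scaled r A t x.
Proof.
move=> cA r0 h; apply: cA => i; rewrite !mxE normrM ger0_norm ?invr_ge0 ?(ltW r0) //.
by rewrite ler_pdivrMl.
Qed.

Lemma scaled_scale A (k s : R) t x : 0 < k -> scaled s A t x ->
  scaled (k * s) A (k *: t) (k *: x).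
Proof.
move=> k0; rewrite /scaled /= -scalerBr scalerA.
have [->|s0] := eqVneq s 0; first by rewrite mulr0 invr0 mul0r.
by have -> : (k * s)^-1 * k = s^-1 by field; rewrite s0 gt_eqF.
Qed.

(** The cube puts the origin into A, so 0 can be added as a point of (r - s)A. *)
Lemma scaled_mono A (s r : R) t x : convex A -> cube_in A -> 0 < s -> s <= r ->
  scaled s A t x -> scaled r A t x.
Proof.
move=> cA qA s0; rewrite le_eqVlt => /orP [/eqP -> //|sr] h.
have -> : r = s + (r - s) by rewrite addrC subrK.
rewrite -(addr0 t) -(addr0 x); apply: scaled_add => //; first by rewrite subr_gt0.
apply: scaled_cube => //; first by rewrite subr_gt0.
by move=> i; rewrite subrr normr0 divr_ge0 // subr_ge0 ltW.
Qed.

Lemma spread_scaled A (L s : R) t : 0 < s -> spread L A -> spread (s * L) (scaled s A t).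
Proof.
move=> s0 hA x y hx hy i; have := hA _ _ hx hy i; rewrite !mxE -mulrBr normrM.
rewrite ger0_norm ?invr_ge0 ?(ltW s0) // ler_pdivrMl //.
by have -> : x 0 i - t 0 i - (y 0 i - t 0 i) = x 0 i - y 0 i by ring.
Qed.

Definition nice A := [/\ convex A, cube_in A & exists2 L, 0 <= L & spread L A].

Definition cnt (s : R) A t : nat := #|` lat (scaled s A t)|.

Lemma in_lat_nice A (s : R) t z : nice A -> 0 < s ->
  (z \in lat (scaled s A t)) = `[< scaled s A t (zr R z) >].
Proof.
move=> [_ _ [L L0 hL]] s0; apply: (@in_lat _ _ (s * L)); first by rewrite mulr_ge0 // ltW.
exact: spread_scaled.
Qed.

Lemma cnt_mono A (s r : R) t : nice A -> 0 < s -> s <= r -> (cnt s A t <= cnt r A t)%N.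
Proof.
move=> nA s0 sr; apply: fsubset_leq_card; apply/fsubsetP => z.
have r0 : 0 < r by exact: lt_le_trans sr.
rewrite !in_lat_nice // => /asboolP h; apply/asboolP; case: nA => ? ? _.
exact: scaled_mono sr h.
Qed.

(* Each lattice point z of [s *: A + t] gives the k^d lattice points of the box kz + [0, k)^d, and
   the unit cube contained in A absorbs this box and the rounding of the translation. *)
Lemma cnt_sub A (k : nat) (s : R) t u : nice A -> (0 < k)%N -> 0 < s ->
  (cnt s A t * k ^ d <= cnt (k%:R * (s + 4)) A u)%N.
Proof.
move=> nA k0 s0; have k0' : 0 < k%:R :> R by rewrite ltr0n.
have [cA qA _] := nA.
have k1 : 1 <= k%:R :> R by rewrite ler1n.
pose v : 'rV[int]_d := \row_i Num.floor (u 0 i - k%:R * t 0 i).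
apply: (@card_subdiv _ _ _ _ v) => [|z j]; first exact: fset_uniq.
rewrite !in_lat_nice // ?mulr_gt0 //; last by lra.
move=> /asboolP hz; apply/asboolP.
(* The term 2k absorbs an offset of at most k per coordinate, and the term 2 a rounding error of at
   most 1; both fit into 4k because k >= 1. *)
apply: (@scaled_mono _ (k%:R * s + k%:R * 2 + 2)) => //; last first.
- have -> : u = k%:R *: t + 0 + (u - k%:R *: t) by rewrite addr0 addrC subrK.
  have -> : zr R (z *+ k + offset j + v) = k%:R *: zr R z + zr R (offset j) + zr R v.
    by apply/rowP => i; rewrite !mxE mulmxnE !rmorphD rmorphMn /= !mulr_natl.
  apply: scaled_add => //; first by rewrite !addr_gt0 // !mulr_gt0.
    apply: scaled_add; rewrite ?mulr_gt0 //; first exact: scaled_scale.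
    apply: scaled_cube; rewrite ?mulr_gt0 // => i; rewrite !mxE subr0.
    have -> : k%:R * 2 / 2 = k%:R :> R by field.
    by rewrite normr_nat ler_nat ltnW.
  apply: scaled_cube => // i; rewrite !mxE divff //.
  set r := u 0 i - _.
  have := Num.Theory.floor_itv r; rewrite intrD => /andP [h1 h2].
  by rewrite ler_norml; lra.
- lra.
- nra.
- by rewrite !addr_gt0 ?mulr_gt0.
Qed.

(** The threshold does not depend on [t], so dilates at uncontrolled positions can be counted. *)
Definition is_density A V := forall e : R, 0 < e < 1 -> exists2 S, 0 < S &
  forall s t, S <= s -> (1 - e) * V * s ^+ d <= (cnt s A t)%:R <= (1 + e) * V * s ^+ d.

Lemma cnt_gt0 A s : nice A -> 0 < s -> (0 < cnt s A 0)%N.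
Proof.
move=> nA s0; rewrite cardfs_gt0; apply/fset0Pn; exists 0.
rewrite in_lat_nice //; apply/asboolP; case: nA => _ qA _.
by apply: scaled_cube => // i; rewrite !mxE subrr normr0 divr_ge0 // ltW.
Qed.

(** V is the supremum of cnt s / (s + 4)^d. [cnt_sub] with k = 1 moves any translate to the origin
    and gives the upper bound. For the lower bound, a nearly optimal s0 is subdivided with the
    largest k such that k (s0 + 4) <= s. *)
Lemma density_exists A : nice A -> exists2 V : R, 0 < V & is_density A V.
Proof.
move=> nA; have [cA qA [L L0 hL]] := nA.
pose E := [set r : R | exists2 s : R, 0 < s & r = (cnt s A 0)%:R / (s + 4) ^+ d]%classic.
have pos4 (s : R) : 0 < s -> 0 < (s + 4) ^+ d by move=> s0; rewrite exprn_gt0 //; lra.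
have ubE : ubound E ((2 * L + 1) ^+ d).
  move=> _ [s s0 ->]; rewrite ler_pdivrMr ?pos4 // -exprMn.
  have sL0 : 0 <= s * L by rewrite mulr_ge0 // ltW.
  have [_ h] := spread_lat sL0 (@spread_scaled _ _ _ 0 s0 hL).
  apply: le_trans h _; apply: lerXn2r; rewrite ?nnegrE; try by nra.
have hasE : has_sup E.
  by split; [exists ((cnt 1 A 0)%:R / (1 + 4) ^+ d); exists 1 | exists ((2 * L + 1) ^+ d)].
have leV s : 0 < s -> (cnt s A 0)%:R <= sup E * (s + 4) ^+ d.
  move=> s0; rewrite -ler_pdivrMr ?pos4 //; apply: ub_le_sup; first by case: hasE.
  by exists s.
have V0 : 0 < sup E.
  have := leV 1 ltr01; have := @cnt_gt0 A 1 nA ltr01; rewrite -(ltr_nat R) => h1 h2.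
  have := lt_le_trans h1 h2; rewrite pmulr_lgt0 // pos4 //.
exists (sup E) => // e /andP [e0 e1].
have e2 : 0 < e / 2 by lra.
have [_ [s0 s0p ->] hs0] := sup_adherent (mulr_gt0 e2 V0) hasE.
have [S1 S1p hS1] := @pow_near R d 8 e (ltW (ltr0Sn _ 7)) e0.
have [S2 S2p hS2] := @pow_near R d (s0 + 4) (e / 2) ltac:(lra) e2.
exists (S1 + S2) => [|s t hs]; first by lra.
have [_ h1 _] := hS1 s ltac:(lra).
have [h2 _ h3] := hS2 s ltac:(lra).
have sp : 0 < s by lra.
apply/andP; split; last first.
  have h4 := @cnt_sub A 1 s t 0 nA isT sp.
  rewrite exp1n muln1 mul1r -(ler_nat R) in h4.
  apply: le_trans h4 _; apply: le_trans (leV _ _) _; first by lra.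
  rewrite [(1 + e) * _]mulrC -mulrA ler_pM2l //; apply: le_trans h1.
  by have -> : s + 4 + 4 = s + 8 by ring.
pose k := Num.truncn (s / (s0 + 4)).
have k1 : (0 < k)%N.
  by rewrite truncn_gt0 ler_pdivlMr ?mul1r; lra.
have kle : k%:R * (s0 + 4) <= s.
  by rewrite -ler_pdivlMr; last lra; rewrite truncn_le divr_ge0 //; lra.
have klt : s - (s0 + 4) <= k%:R * (s0 + 4).
  have := truncnS_gt (s / (s0 + 4)); rewrite -/k -[k.+1%:R]natr1 ltr_pdivrMr; last by lra.
  by lra.
have kp : 0 < k%:R :> R by rewrite ltr0n.
have h4 : (cnt s0 A 0 * k ^ d <= cnt s A t)%N.
  by apply: leq_trans (cnt_sub _ t nA k1 s0p) _; apply: cnt_mono => //; rewrite mulr_gt0 //; lra.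
rewrite -(ler_nat R) natrM natrX in h4; apply: le_trans h4.
have h5 : (1 - e / 2) * sup E * (s0 + 4) ^+ d <= (cnt s0 A 0)%:R.
  by rewrite -ler_pdivlMr ?pos4 //; lra.
have kd0 : 0 <= k%:R ^+ d :> R by rewrite exprn_ge0 // ltW.
apply: le_trans (ler_wpM2r kd0 h5).
have -> : (1 - e / 2) * sup E * (s0 + 4) ^+ d * k%:R ^+ d =
          (1 - e / 2) * sup E * (k%:R * (s0 + 4)) ^+ d by rewrite exprMn; ring.
have h6 : (s - (s0 + 4)) ^+ d <= (k%:R * (s0 + 4)) ^+ d.
  by apply: lerXn2r => //; rewrite nnegrE; lra.
have h7 : (1 - e / 2) * s ^+ d <= (k%:R * (s0 + 4)) ^+ d by exact: le_trans h6.
have h8 : 0 <= (1 - e / 2) * sup E by rewrite mulr_ge0 ?(ltW V0) //; lra.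
apply: le_trans (ler_wpM2l h8 h7).
have x0 : 0 <= sup E * s ^+ d by rewrite mulr_ge0 ?exprn_ge0 // ltW.
nra.
Qed.
End Counting.

(** * The Rogers-Shephard inequality *)

(** Subsets of size a + b + 1 of {0, ..., m}, sorted by their element j with b chosen elements below
    it and a above it. The induction uses Pascal's rule. *)
Lemma sum_bin_conv a b m : (\sum_(j < m.+1) 'C(m - j, a) * 'C(j, b) = 'C(m.+1, (a + b).+1))%N.
Proof.
elim: m a => [|m IH] a.
  rewrite big_ord1 /= subnn; case: a => [|a]; last by rewrite bin_small ?mul0n ?bin_small.
  by rewrite bin0 mul1n add0n; case: b => [|b]; rewrite ?binn ?bin_small.
rewrite big_ord_recr /= subnn; case: a => [|a].
  rewrite bin0 mul1n binS add0n -[in RHS](add0n b) -IH; congr addn.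
  by apply: eq_bigr => j _; rewrite !bin0.
rewrite (bin_small (ltn0Sn a)) mul0n addn0 binS addSn -IH -addSn -IH -big_split /=.
by apply: eq_bigr => j _; rewrite subSn ?leq_ord // binS mulnDl.
Qed.

Lemma expn_step i n : (i ^ n.+1 + n.+1 * i ^ n <= i.+1 ^ n.+1)%N.
Proof.
elim: n => [|n IH]; first by rewrite !expn1 expn0 muln1 addn1.
rewrite [(i.+1 ^ _)%N]expnS; apply: leq_trans (leq_mul (leqnn i.+1) IH).
by rewrite !expnS; move: (i ^ n)%N => p; lia.
Qed.

Lemma ffact_le_exp i n : (i ^_ n <= i ^ n)%N.
Proof.
elim: n => [|n IH]; first by rewrite ffactn0.
by rewrite ffactnSr expnSr leq_mul // leq_subr.
Qed.

Lemma exp_le_ffact i n : ((i - n) ^ n <= i ^_ n)%N.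
Proof.
have h m : (m <= n -> (i - n) ^ m <= i ^_ m)%N.
  elim: m => [|m IH] mn; first by rewrite ffactn0.
  rewrite ffactnSr expnSr leq_mul ?IH ?(ltnW mn) //.
  by rewrite leq_sub2l // ltnW.
exact: h.
Qed.

(* A Riemann sum for the Beta integral of [d (1-t)^(d-1) t^d]. *)
Lemma beta_sum n d : (0 < d)%N -> (0 < n)%N ->
  (d`! * d`! * 'C(n, 2 * d) <=
   \sum_(1 <= j < n) ((n - j) ^ d - (n - j.+1) ^ d) * j ^ d)%N.
Proof.
case: d => // d _; case: n => // n _.
have -> : (2 * d.+1 = (d + d.+1).+1)%N by lia.
rewrite -sum_bin_conv big_ord_recl bin0n muln0 add0n big_distrr /=.
rewrite big_add1 /= big_mkord; apply: leq_sum => j _.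
rewrite /bump /= add1n !subSS.
set i := (n - j.+1)%N.
have -> : (n - j = i.+1)%N by rewrite /i; have := ltn_ord j; lia.
(* The difference of consecutive powers is at least (d + 1) i^d, by [expn_step], and i^d is at least
   d! times the binomial coefficient. *)
have h1 : (d.+1`! * 'C(i, d) <= i.+1 ^ d.+1 - i ^ d.+1)%N.
  rewrite leq_subRL ?leq_exp2r // ?(leq_trans _ (expn_step i d)) //.
  by rewrite leq_add2l factS -mulnA leq_mul // mulnC bin_ffact ffact_le_exp.
have h2 : (d.+1`! * 'C(j.+1, d.+1) <= j.+1 ^ d.+1)%N.
  by rewrite mulnC bin_ffact ffact_le_exp.
by apply: leq_trans (leq_mul h1 h2); rewrite mulnACA.
Qed.

Lemma le_of_eps (R : realType) (x y : R) : 0 <= x -> 0 <= y ->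
  (forall e, 0 < e < 1 -> (1 - e) ^+ 2 * x <= (1 + e) ^+ 2 * y) -> x <= y.
Proof.
move=> x0 y0 h; rewrite leNgt; apply/negP => yx.
have q0 : 0 < 2 * (2 * x + 3 * y) by lra.
(* With this e, (1 - 2e) x <= (1 + 3e) y would give x - y <= e (2x + 3y) = (x - y)/2. *)
pose e := (x - y) / (2 * (2 * x + 3 * y)).
have e0 : 0 < e by rewrite divr_gt0 //; lra.
have e1 : e < 1 / 2 by rewrite ltr_pdivrMr //; lra.
have eE : e * (2 * (2 * x + 3 * y)) = x - y by rewrite divfK // gt_eqF.
clearbody e.
have := h e ltac:(lra).
have e2 : 0 <= e ^+ 2 * x by rewrite mulr_ge0 // exprn_ge0 // ltW.
have e3 : 0 <= e * (1 - e) * y by rewrite !mulr_ge0 //; lra.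
nra.
Qed.

(** Terms before the first j with [P j] vanish; from that j on, the sum is at most the telescoping g
    j - g n. *)
Lemma abel_sum_le (R : realType) (g : nat -> R) (n : nat) (P : pred nat) (F : R) :
  (forall j, (1 <= j < n)%N -> g j.+1 <= g j) -> 0 <= g n -> 0 <= F ->
  (forall j, (1 <= j < n)%N -> P j -> g j <= F) ->
  \sum_(1 <= j < n) (g j - g j.+1) * (P j)%:R <= F.
Proof.
move=> gd gn F0 hF.
have h k m : (m + k = n)%N -> (1 <= m)%N -> \sum_(m <= j < n) (g j - g j.+1) * (P j)%:R <= F.
  elim: k m => [|k IH] m mk m1; first by rewrite big_geq // -mk addn0.
  have mn : (m < n)%N by rewrite -mk -addSnnS leq_addr.
  case Pm: (P m); last by rewrite big_ltn // Pm mulr0 add0r IH // addSnnS.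
  apply: le_trans (hF m _ Pm); last by rewrite m1.
  apply: (@le_trans _ _ (\sum_(m <= j < n) (g j - g j.+1))).
    rewrite big_nat [leRHS]big_nat; apply: ler_sum => j /andP [mj jn].
    rewrite ler_piMr ?lern1 ?leq_b1 // subr_ge0 gd // jn andbT.
    exact: leq_trans mj.
  have -> : \sum_(m <= j < n) (g j - g j.+1) = - \sum_(m <= j < n) (g j.+1 - g j).
    by rewrite -sumrN; apply: eq_bigr => j _; rewrite opprB.
  by rewrite telescope_sumr ?(ltnW mn) // opprB gerBl.
case: (posnP n) => [->|n0]; first by rewrite big_geq.
by apply: (h n.-1) => //; rewrite add1n prednK.
Qed.

Section PairCount.
Variable V : zmodType.

(** Double counting of the pairs (x, y) in X and Y by their difference t = x - y: each pair occurs
    at most once, and all occur if D contains every difference. *)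
Lemma pair_count (X Y D : seq V) :
  (\sum_(t <- D) count (fun x => (x - t)%R \in Y) X =
   \sum_(x <- X) count (fun t => (x - t)%R \in Y) D)%N.
Proof.
transitivity (\sum_(t <- D) \sum_(x <- X) ((x - t)%R \in Y : nat))%N.
  by apply: eq_bigr => t _; rewrite -sum1_count big_mkcond.
by rewrite exchange_big; apply: eq_bigr => x _; rewrite -sum1_count [RHS]big_mkcond.
Qed.

Lemma pair_count_le (X Y D : seq V) : uniq D ->
  (\sum_(t <- D) count (fun x => (x - t)%R \in Y) X <= size X * size Y)%N.
Proof.
move=> uD; rewrite pair_count -sum1_size big_distrl /=; apply: leq_sum => x _.
rewrite mul1n -size_filter -(size_map (fun t => x - t)); apply: uniq_leq_size.
  by rewrite map_inj_uniq ?filter_uniq // => a b /addrI /oppr_inj.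
by move=> u /mapP [t]; rewrite mem_filter => /andP [? _] ->.
Qed.

Lemma pair_count_ge (X Y D : seq V) : uniq Y ->
  (forall x y, x \in X -> y \in Y -> (x - y)%R \in D) ->
  (size X * size Y <= \sum_(t <- D) count (fun x => (x - t)%R \in Y) X)%N.
Proof.
move=> uY h; rewrite pair_count -sum1_size big_distrl /= big_seq [leqRHS]big_seq.
apply: leq_sum => x xX.
rewrite mul1n -size_filter -(size_map (fun t => x - t)); apply: uniq_leq_size.
  by rewrite map_inj_uniq // => a b /addrI /oppr_inj.
move=> u /mapP [y yY ->]; rewrite mem_filter h // andbT.
by rewrite opprB addrC subrK.
Qed.

End PairCount.

Section Difference.
Variables (R : realType) (d : nat).
Implicit Types (A B K : set 'rV[R]_d) (x y t : 'rV[R]_d) (z w : 'rV[int]_d).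

Definition diffset K : set 'rV[R]_d := [set u | exists x y, [/\ K x, K y & u = x - y]].

Lemma nice_diffset K : nice K -> nice (diffset K).
Proof.
move=> [cK qK [L L0 hL]].
have K0 : K 0 by apply: qK => i; rewrite mxE normr0 invr_ge0.
split.
- move=> _ _ s [x [y [Kx Ky ->]]] [x' [y' [Kx' Ky' ->]]] hs.
  exists (s *: x + (1 - s) *: x'), (s *: y + (1 - s) *: y'); split; try exact: cK.
  by rewrite !scalerBr opprD addrACA.
- by move=> x hx; exists x, 0; split; rewrite ?subr0 //; exact: qK.
- exists (2 * L); first by rewrite mulr_ge0.
  move=> _ _ [x [y [Kx Ky ->]]] [x' [y' [Kx' Ky' ->]]] i; rewrite !mxE.
  have -> : x 0 i - y 0 i - (x' 0 i - y' 0 i) = (x 0 i - x' 0 i) + (y' 0 i - y 0 i) by ring.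
  apply: le_trans (ler_normD _ _) _.
  by have := hL _ _ Kx Kx' i; have := hL _ _ Ky' Ky i; lra.
Qed.

Lemma scaled_diffset K s x : 0 < s -> scaled s (diffset K) 0 x ->
  exists a b, [/\ scaled s K 0 a, scaled s K 0 b & x = a - b].
Proof.
rewrite /scaled /= subr0 => s0 [a [b [Ka Kb e]]]; exists (s *: a), (s *: b).
have s0' : s != 0 by rewrite gt_eqF.
by rewrite !subr0 !scalerA mulVf // !scale1r -scalerBr -e scalerA divff // scale1r.
Qed.

Lemma sub_scaled_diffset K s t a b : scaled s K t a -> scaled s K t b ->
  scaled s (diffset K) 0 (a - b).
Proof.
rewrite /scaled /= subr0 => Ka Kb; exists (s^-1 *: (a - t)), (s^-1 *: (b - t)); split=> //.
by rewrite -scalerBr opprB addrA subrK.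
Qed.

(** Since a - b = a + (s tau - b) - s tau, the set s(K - K) lies in a translate of 2sK. The centre
    is tau/2 instead of 0 because the normalization may move it. *)
Lemma sym_density K VK VD : nice K -> is_density K VK -> is_density (diffset K) VD ->
  0 < VK -> 0 < VD ->
  (exists tau, forall x, K x -> K (tau - x)) -> VD <= 2 ^+ d * VK.
Proof.
move=> nK dK dD VK0 VD0 [tau ht]; apply: le_of_eps; rewrite ?mulr_ge0 ?exprn_ge0 ?ltW //.
move=> e e01; have [S1 S1p h1] := dK _ e01; have [S2 S2p h2] := dD _ e01.
pose s := S1 + S2; have s0 : 0 < s by rewrite addr_gt0.
have /andP [_ hK] := h1 (2 * s) (- (s *: tau)) ltac:(rewrite /s; lra).
have /andP [hD _] := h2 s 0 ltac:(rewrite /s; lra).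
have h : (cnt s (diffset K) 0 <= cnt (2 * s) K (- (s *: tau)))%N.
  apply: fsubset_leq_card; apply/fsubsetP => z.
  have nD := nice_diffset nK.
  rewrite !in_lat_nice ?mulr_gt0 // => /asboolP /(scaled_diffset s0) [a [b [Ka Kb zE]]].
  apply/asboolP; rewrite zE mulrDl mul1r -[- _]add0r; apply: scaled_add => //; first by case: nK.
  rewrite /scaled /= opprK addrC; move: Kb; rewrite /scaled /= subr0 => /ht.
  by rewrite scalerBr scalerA mulVf ?gt_eqF // scale1r.
rewrite -(ler_nat R) in h.
have := le_trans hD (le_trans h hK); rewrite exprMn mulrA.
rewrite ler_pM2r ?exprn_gt0 // => {}h.
have /andP [e0 e1] := e01.
have a1 : (1 - e) ^+ 2 * VD <= (1 - e) * VD.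
  by rewrite ler_pM2r // expr2 ler_piMr //; lra.
have a2 : (1 + e) * (2 ^+ d * VK) <= (1 + e) ^+ 2 * (2 ^+ d * VK).
  rewrite ler_pM2r ?mulr_gt0 ?exprn_gt0 // expr2 ler_peMr //; lra.
by apply: le_trans a1 (le_trans h _); apply: le_trans a2; rewrite -mulrA [VK * _]mulrC.
Qed.

End Difference.
Section RogersShephard.
Variables (R : realType) (d : nat).
Implicit Types (A B K : set 'rV[R]_d) (x y t : 'rV[R]_d) (z w : 'rV[int]_d).

Lemma zrB z w : zr R (z - w) = zr R z - zr R w.
Proof. by apply/rowP => i; rewrite !mxE rmorphB. Qed.

(* If z = jr(a - b), then [jr *: a + (n-j)r *: K] lies in [nr *: K] and in its translate by z. *)
Lemma cnt_layer K (n j : nat) (r : R) z : nice K -> 0 < r -> (0 < j < n)%N ->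
  z \in lat (scaled (j%:R * r) (diffset K) 0) ->
  exists t, (cnt ((n - j)%:R * r) K t <=
    count (fun w => (w - z)%R \in lat (scaled (n%:R * r) K 0)) (lat (scaled (n%:R * r) K 0)))%N.
Proof.
move=> nK r0 /andP [j0 jn]; have nD := nice_diffset nK; have [cK _ _] := nK.
have jr0 : 0 < j%:R * r by rewrite mulr_gt0 ?ltr0n.
have njr0 : 0 < (n - j)%:R * r by rewrite mulr_gt0 ?ltr0n ?subn_gt0.
have nr0 : 0 < n%:R * r by rewrite mulr_gt0 ?ltr0n //; apply: ltn_trans jn.
rewrite in_lat_nice // => /asboolP /(scaled_diffset jr0) [a [b [Ka Kb zE]]].
exists a; rewrite -size_filter; apply: uniq_leq_size; first exact: fset_uniq.
have nE : n%:R * r = j%:R * r + (n - j)%:R * r by rewrite -mulrDl -natrD subnKC // ltnW.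
move=> y; rewrite mem_filter !in_lat_nice // => /asboolP Ky.
have Ky' : scaled ((n - j)%:R * r) K 0 (zr R y - a) by rewrite /scaled /= subr0.
apply/andP; split; apply/asboolP; rewrite nE -(addr0 0).
  have -> : zr R (y - z) = b + (zr R y - a).
    by rewrite zrB zE opprB addrC addrA addrAC.
  exact: scaled_add.
have -> : zr R y = a + (zr R y - a) by rewrite addrC subrK.
exact: scaled_add.
Qed.

(* Counting pairs of lattice points of [nr *: K] by their difference, layer by layer in
   [nr *: (K - K)], bounds VD from above by a Riemann sum that [beta_sum] evaluates. *)
Lemma rogers_shephard K VK VD : (0 < d)%N -> nice K ->
  is_density K VK -> is_density (diffset K) VD -> 0 < VK -> 0 < VD ->
  VD <= 'C(2 * d, d)%:R * VK.
Proof.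
move=> d0 nK dK dD VK0 VD0; have nD := nice_diffset nK.
have main n : (0 < n)%N -> VD * (d`! * d`! * 'C(n, 2 * d))%N%:R <= VK * n%:R ^+ (2 * d).
  move=> n0; apply: le_of_eps; rewrite ?mulr_ge0 ?exprn_ge0 ?(ltW VK0) ?(ltW VD0) //.
  move=> e e01; have [S1 S1p h1] := dK _ e01; have [S2 S2p h2] := dD _ e01.
  have /andP [e0 e1] := e01.
  pose r := S1 + S2; have r0 : 0 < r by rewrite addr_gt0.
  have big m : (0 < m)%N -> S1 <= m%:R * r /\ S2 <= m%:R * r.
    by rewrite -(ler1n R) => m1; have : r <= m%:R * r; [rewrite ler_peMl // ltW|rewrite /r; lra].
  pose X := lat (scaled (n%:R * r) K 0).
  pose D := lat (scaled (n%:R * r) (diffset K) 0).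
  pose f z := count (fun w => (w - z)%R \in X) X.
  (* [g j] bounds from below the number of pairs whose difference lies in layer j. By [abel_sum_le],
     [f z] dominates the decrements of [g] over all layers that contain z; exchanging the sums
     leaves the sizes of the layers. *)
  pose g j := (1 - e) * VK * ((n - j)%:R * r) ^+ d.
  pose P z j := z \in lat (scaled (j%:R * r) (diffset K) 0).
  have gge0 j : 0 <= g j by rewrite mulr_ge0 // ?exprn_ge0 ?mulr_ge0 ?(ltW r0) ?(ltW VK0) //; lra.
  have hf z j : (1 <= j < n)%N -> P z j -> g j <= (f z)%:R.
    move=> jn Pz; have [t ht] := cnt_layer nK r0 jn Pz.
    have nj0 : (0 < n - j)%N by rewrite subn_gt0; case/andP: jn.
    have [B1 _] := big _ nj0.
    have /andP [h _] := h1 _ t B1; apply: le_trans h _.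
    by rewrite ler_nat.
  have up : (\sum_(z <- D) f z)%N%:R <= ((1 + e) * VK * (n%:R * r) ^+ d) ^+ 2.
    have hX : (size X)%:R <= (1 + e) * VK * (n%:R * r) ^+ d.
      by have /andP [_ h] := h1 _ 0 (big _ n0).1.
    rewrite expr2; apply: (@le_trans _ _ ((size X * size X)%N%:R)).
      by rewrite ler_nat; apply: pair_count_le; apply: fset_uniq.
    by rewrite natrM ler_pM.
  have low : \sum_(1 <= j < n) (g j - g j.+1) * ((1 - e) * VD * (j%:R * r) ^+ d) <=
             (\sum_(z <- D) f z)%N%:R.
    rewrite natr_sum.
    apply: (@le_trans _ _ (\sum_(z <- D) \sum_(1 <= j < n) (g j - g j.+1) * (P z j)%:R)); last first.
      apply: ler_sum => z _; apply: abel_sum_le => //; last by move=> j; apply: hf.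
      move=> j _; rewrite /g ler_wpM2l //; first by rewrite mulr_ge0 ?(ltW VK0) //; lra.
      apply: lerXn2r; rewrite ?nnegrE ?mulr_ge0 ?(ltW r0) //.
      by rewrite ler_wpM2r ?(ltW r0) // ler_nat leq_sub2l.
    rewrite exchange_big /= big_nat [leRHS]big_nat; apply: ler_sum => j /andP [j1 jn].
    rewrite -mulr_sumr; apply: ler_wpM2l.
      rewrite subr_ge0 /g ler_wpM2l //; first by rewrite mulr_ge0 ?(ltW VK0) //; lra.
      apply: lerXn2r; rewrite ?nnegrE ?mulr_ge0 ?(ltW r0) //.
      by rewrite ler_wpM2r ?(ltW r0) // ler_nat leq_sub2l.
    have /andP [h _] := h2 _ 0 (big _ j1).2; apply: le_trans h _.
    rewrite -natr_sum ler_nat /cnt.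
    have -> : (\sum_(z <- D) P z j = count (P^~ j) D)%N.
      by rewrite -sum1_count [RHS]big_mkcond; apply: eq_bigr => z _; case: (P z j).
    rewrite -size_filter; apply: uniq_leq_size; first exact: fset_uniq.
    move=> z zj; rewrite mem_filter; apply/andP; split; first exact: zj.
    have jr0 : 0 < j%:R * r by rewrite mulr_gt0 ?ltr0n.
    have jnr : j%:R * r <= n%:R * r by rewrite ler_wpM2r ?(ltW r0) // ler_nat ltnW.
    have nr0 := lt_le_trans jr0 jnr.
    move: zj; rewrite /D !in_lat_nice // => /asboolP h3; apply/asboolP.
    by case: nD => ? ? _; exact: scaled_mono h3.
  have eqs : \sum_(1 <= j < n) (g j - g j.+1) * ((1 - e) * VD * (j%:R * r) ^+ d) =
     (1 - e) ^+ 2 * VK * VD * r ^+ (2 * d) *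
     (\sum_(1 <= j < n) ((n - j) ^ d - (n - j.+1) ^ d) * j ^ d)%N%:R.
    rewrite natr_sum mulr_sumr; apply: eq_bigr => j _.
    rewrite natrM natrB ?leq_exp2r ?leq_sub2l // !natrX /g !exprMn mul2n -addnn exprD.
    by ring.
  have {}low := le_trans low up; rewrite eqs in low.
  have hb : ((d`! * d`! * 'C(n, 2 * d))%N%:R : R) <=
     (\sum_(1 <= j < n) ((n - j) ^ d - (n - j.+1) ^ d) * j ^ d)%N%:R.
    by rewrite ler_nat; apply: beta_sum.
  have c0 : 0 < VK * r ^+ (2 * d) by rewrite mulr_gt0 ?exprn_gt0.
  rewrite -(ler_pM2l c0).
  have c1 : 0 <= (1 - e) ^+ 2 * VK * VD * r ^+ (2 * d).
    by rewrite !mulr_ge0 ?exprn_ge0 ?(ltW VK0) ?(ltW VD0) ?(ltW r0) //; lra.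
  have := le_trans (ler_wpM2l c1 hb) low; congr (_ <= _); first by ring.
  by rewrite !exprMn -!exprM [(d * 2)%N]mulnC; ring.
(* Now n tends to infinity in [main]: C(2d, d) d! d! C(n, 2d) is the falling factorial of n of
   length 2d, at least (n - 2d)^(2d). *)
apply: le_of_eps; rewrite ?mulr_ge0 ?(ltW VK0) ?(ltW VD0) //.
move=> e /andP [e0 e1].
have [S S0 hS] := @pow_near R (2 * d) (2 * d)%:R e (ler0n _ _) e0.
pose n := (2 * d + (Num.truncn S).+1)%N.
have Sn : S <= n%:R by rewrite /n natrD; have := truncnS_gt S; have := ler0n R (2 * d); lra.
have [_ _ h1] := hS _ Sn.
have n0 : (0 < n)%N by rewrite /n addnS.
have h2 := main n n0.
have nd : (2 * d <= n)%N by rewrite leq_addr.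
have h3 : ((n - 2 * d) ^ (2 * d) <= 'C(2 * d, d) * (d`! * d`! * 'C(n, 2 * d)))%N.
  apply: leq_trans (exp_le_ffact _ _) _; rewrite -bin_ffact mulnA.
  have := @bin_fact (2 * d) d; have -> : (2 * d - d)%N = d by lia.
  move=> ->; last by lia.
  by rewrite mulnC.
rewrite -(ler_nat R) natrX natrB // [leRHS]natrM in h3.
have npos : 0 < n%:R ^+ (2 * d) :> R by rewrite exprn_gt0 // ltr0n.
have h4 : (1 - e) * VD <= 'C(2 * d, d)%:R * VK.
  rewrite -(ler_pM2r npos).
  apply: (@le_trans _ _ (VD * (n%:R - (2 * d)%:R) ^+ (2 * d))).
    by rewrite [(1 - e) * _]mulrC -mulrA ler_pM2l.
  apply: (@le_trans _ _ (VD * ('C(2 * d, d)%:R * (d`! * d`! * 'C(n, 2 * d))%N%:R))).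
    by rewrite ler_pM2l.
  by rewrite mulrCA -[leRHS]mulrA ler_wpM2l.
have V0 : 0 <= 'C(2 * d, d)%:R * VK by rewrite mulr_ge0 // ltW.
apply: (@le_trans _ _ ((1 - e) * VD)).
  by rewrite ler_pM2r // expr2 ler_piMr //; lra.
apply: le_trans h4 _; rewrite ler_peMl //; nra.
Qed.
End RogersShephard.
(** * Greedy and dyadic coverings *)

Section Greedy.
Variables (R : realType) (d : nat).
Implicit Types (K : set 'rV[R]_d) (z t : 'rV[int]_d).

(** Pigeonhole: all differences between X and the points of msK are lattice points of s(K - K), so
    some such t attains at least the average number of pairs. *)
Lemma greedy_step K (s m : R) (X : seq 'rV[int]_d) : nice K -> 0 < s -> 0 < m <= 1 ->
  {subset X <= lat (scaled s K 0)} ->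
  exists t, (size X * #|` lat (scaled (m * s) K 0)| <=
    count (fun z => (z - t)%R \in lat (scaled (m * s) K 0)) X * #|` lat (scaled s (diffset K) 0)|)%N.
Proof.
move=> nK s0 /andP [m0 m1] XK; have nD := nice_diffset nK; have [cK qK _] := nK.
have ms0 : 0 < m * s by rewrite mulr_gt0.
set Y := lat (scaled (m * s) K 0); set D := lat (scaled s (diffset K) 0).
have := @pair_count_ge _ X Y D (fset_uniq _).
have sub x y : x \in X -> y \in Y -> (x - y)%R \in D.
  move=> /XK; rewrite !in_lat_nice // => /asboolP Kx /asboolP Ky; apply/asboolP.
  rewrite zrB; apply: sub_scaled_diffset Kx _; apply: scaled_mono Ky => //.
  by rewrite ler_piMl // ltW.
move=> /(_ sub) h; apply: contrapT => /forallNP nt.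
have D0 : (0 < size D)%N := cnt_gt0 nD s0.
have : (\sum_(t <- D) count (fun z => (z - t)%R \in Y) X * #|` D| < \sum_(t <- D) (size X * size Y))%N.
  have : (\sum_(t <- D) (count (fun z => (z - t)%R \in Y) X * #|` D|).+1 <=
          \sum_(t <- D) (size X * size Y))%N.
    by apply: leq_sum => t _; rewrite ltnNge; apply/negP; exact: nt.
  apply: leq_trans; rewrite -addn1; apply: leq_trans (leq_add (leqnn _) D0) _.
  by rewrite -sum1_size -big_split /=; apply: leq_sum => t _; rewrite addn1.
rewrite -big_distrl /= big_const_seq count_predT iter_addn_0 ltnNge.
by rewrite mulnC [X in (_ <= X)%N]mulnC leq_mul // leqnn.
Qed.

(** Placing [i] removes at least the fraction [q i] of the points that the rest of the list misses,
    and 1 - q <= exp(-q). *)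
Lemma greedy K (s : R) (T : eqType) (m q : T -> R) (X : seq 'rV[int]_d) (l : seq T) :
  nice K -> 0 < s -> {subset X <= lat (scaled s K 0)} -> uniq l ->
  (forall i, i \in l -> 0 < m i <= 1 /\
    q i * #|` lat (scaled s (diffset K) 0)|%:R <= #|` lat (scaled (m i * s) K 0)|%:R) ->
  exists t : T -> 'rV[int]_d,
    (size [seq z <- X | all (fun i => (z - t i)%R \notin lat (scaled (m i * s) K 0)) l])%:R <=
      expR (- \sum_(i <- l) q i) * (size X)%:R.
Proof.
move=> nK s0 XK; elim: l => [|i l IH] /=.
  by move=> _ _; exists (fun=> 0); rewrite filter_predT big_nil oppr0 expR0 mul1r.
move=> /andP [il ul] h; have [||t ht] := IH => //.
  by move=> j jl; apply: h; rewrite inE jl orbT.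
have [mi hq] := h i (mem_head _ _).
set X' := [seq z <- X | _] in ht.
have X'K : {subset X' <= lat (scaled s K 0)}.
  by move=> z; rewrite mem_filter => /andP [_ /XK].
have [ti hti] := greedy_step nK s0 mi X'K.
exists (fun j => if j == i then ti else t j).
set Y := lat (scaled (m i * s) K 0) in hq hti *.
have -> : [seq z <- X | all (fun j => (z - (if j == i then ti else t j))%R
    \notin lat (scaled (m j * s) K 0)) (i :: l)] = [seq z <- X' | (z - ti)%R \notin Y].
  rewrite -filter_predI; apply: eq_filter => z /=; rewrite eqxx; congr andb.
  apply: eq_in_all => j jl; case: eqP => // ji; by rewrite -ji jl in il.
rewrite big_cons opprD expRD -mulrA; apply: (@le_trans _ _ (expR (- q i) * (size X')%:R)); last first.
  by rewrite ler_pM2l ?expR_gt0.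
rewrite size_filter; have := count_predC (fun z => (z - ti)%R \in Y) X'.
set c := count _ X' in hti *; set c' := count _ X' => hc.
have D0 : 0 < #|` lat (scaled s (diffset K) 0)|%:R :> R.
  by rewrite ltr0n; apply: cnt_gt0 => //; exact: nice_diffset.
have h1 : q i * (size X')%:R <= c%:R.
  rewrite -(ler_pM2r D0) mulrAC; apply: (@le_trans _ _ (#|` Y|%:R * (size X')%:R)).
    by rewrite ler_wpM2r.
  by rewrite -!natrM ler_nat mulnC.
have h2 : c%:R + c'%:R = (size X')%:R :> R by rewrite -natrD -hc.
have h3 : (1 - q i) * (size X')%:R <= expR (- q i) * (size X')%:R.
  by rewrite ler_wpM2r // expR_ge1Dx.
by apply: le_trans h3; lra.
Qed.
End Greedy.

Section Dyadic.
Variables (R : realType) (d : nat).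

Definition cube (b : 'rV[R]_d) (a : R) : set 'rV[R]_d :=
  [set y | forall i, b 0 i <= y 0 i <= b 0 i + a].

(* Use the cubes of side a first, one per target cube, then halve the remaining target cubes. *)
Lemma dyadic_cover (T : finType) (j : T -> nat) (J : nat) (B : seq 'rV[R]_d) (a : R) (S : {set T}) :
  0 <= a -> (forall i, i \in S -> (j i < J)%N) ->
  (size B * 2 ^ (d * J) <= \sum_(i in S) 2 ^ (d * (J - j i)))%N ->
  exists t : T -> 'rV[R]_d, forall b y, b \in B -> cube b a y ->
    exists2 i, i \in S & cube (t i) (a / 2 ^+ j i) y.
Proof.
elim: J j B a S => [|J IH] j B a S a0 hj hB.
  have S0 : S = finset.set0 by apply/setP => i; rewrite finset.in_set0; apply/negP => /hj.
  move: hB; rewrite S0 big_set0 muln0 expn0 muln1 leqn0 size_eq0 => /eqP ->.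
  by exists (fun=> 0) => b y; rewrite in_nil.
pose S0 := [set i in S | j i == 0%N]%SET; pose S1 := (S :\: S0)%SET.
have inS1 i : (i \in S1) = (i \in S) && (0 < j i)%N.
  by rewrite finset.in_setD finset.in_set lt0n; case: (i \in S); case: (j i == 0%N).
pose sub (b : 'rV[R]_d) (e : 'rV['I_2]_d) := b + (a / 2) *: zr R (offset e).
pose B1 := [seq sub b e | b <- drop #|S0| B, e <- enum {: 'rV['I_2]_d}].
have [|||t ht] := IH (fun i => (j i).-1) B1 (a / 2) S1; first by rewrite divr_ge0.
- by move=> i; rewrite inS1 => /andP [/hj]; lia.
(* Volumes are counted in cubes of the finest level: [S0] accounts for exactly its number of target
   cubes, so [S1] has enough volume left for the others. *)
- rewrite size_allpairs size_drop -cardE card_rV_ord -mulnA -expnD -mulnS mulnBl leq_subLR.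
  apply: leq_trans hB _.
  have S0S : S0 \subset S by apply/fintype.subsetP => i; rewrite finset.in_set => /andP [].
  rewrite (big_setID S0) /= (finset.setIidPr S0S) leq_add //.
    rewrite -sum_nat_const; apply: leq_sum => i; rewrite finset.in_set => /andP [_ /eqP ->].
    by rewrite subn0.
  apply: leq_sum => i; rewrite inS1 => /andP [_ ji].
  by rewrite leq_exp2l // leq_mul2l; apply/orP; right; lia.
exists (fun i => if i \in S0 then nth 0 B (index i (enum S0)) else t i) => b y bB hy.
have [bn|bn] := ltnP (index b B) #|S0|.
  have i0 : T by move: bn; rewrite cardE; case: (enum S0) => [|i0 _] //; rewrite ltn0.
  pose i := nth i0 (enum S0) (index b B).
  have iS0 : i \in S0 by rewrite -mem_enum mem_nth // -cardE.
  exists i; first by move: iS0; rewrite finset.in_set => /andP [].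
  rewrite iS0 index_uniq ?enum_uniq -?cardE // nth_index //.
  by move: iS0; rewrite finset.in_set => /andP [_ /eqP ->]; rewrite expr0 divr1.
pose e : 'rV['I_2]_d := \row_i (if b 0 i + a / 2 <= y 0 i then 1 else 0).
have bd : b \in drop #|S0| B.
  rewrite -(nth_index 0 bB) -(subnKC bn) -nth_drop mem_nth // size_drop.
  by rewrite ltn_sub2r // ?index_mem //; apply: leq_ltn_trans bn _; rewrite index_mem.
have [||i iS hi] := ht (sub b e) y.
- by apply/allpairsP; exists (b, e); rewrite /= bd mem_enum.
- move=> i; have /andP [h1 h2] := hy i; rewrite !mxE.
  by case: ifP => h /=; rewrite ?mulr1 ?mulr0; move: h; lra.
move: iS; rewrite inS1 => /andP [iS ji]; exists i => //.
rewrite ifF; last by rewrite finset.in_set iS /=; lia.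
move: hi; rewrite -[in X in _ -> X](prednK ji) exprS invfM mulrA.
by [].
Qed.

(** Each ratio is rounded down to some a/2^j with j minimal. This loses at most the factor m: for j
    = 0 by the bound m a, otherwise by minimality and 2 <= m. Hence volume (m a)^d per target cube
    suffices. *)
Lemma tail_cover (K : set 'rV[R]_d) (T : finType) (lam : T -> R) (S : {set T})
  (B : seq 'rV[R]_d) (a m : R) : cube_in K -> 0 < a -> 2 <= m ->
  (forall i, i \in S -> 0 < lam i <= m * a) ->
  (size B)%:R * (m * a) ^+ d <= \sum_(i in S) lam i ^+ d ->
  exists t : T -> 'rV[R]_d, forall b y, b \in B -> cube b a y ->
    exists2 i, i \in S & scaled (lam i) K (t i) y.
Proof.
move=> qK a0 m2 hl hB.
have ex i : exists n, ~~ (i \in S) || (a / 2 ^+ n <= lam i).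
  case iS: (i \in S) => /=; last by exists 0%N.
  have /andP [l0 _] := hl _ iS.
  exists (Num.truncn (a / lam i)).+1; rewrite ler_pdivrMr ?exprn_gt0 // mulrC -ler_pdivrMr //.
  apply: ltW; apply: lt_le_trans (truncnS_gt _) _.
  by rewrite -natrX ler_nat ltnW // ltn_expl.
pose j i := ex_minn (ex i).
have hj i : i \in S -> a / 2 ^+ j i <= lam i /\ lam i <= m * (a / 2 ^+ j i).
  move=> iS; rewrite /j; case: ex_minnP => n; rewrite iS /= => h1 h2; split=> //.
  have /andP [l0 lm] := hl _ iS.
  case: n h1 h2 => [|n] h1 h2; first by rewrite expr0 divr1.
  have : lam i < a / 2 ^+ n by rewrite ltNge; apply/negP => /h2; rewrite ltnn.
  move=> /ltW h3.
  have x0 : 0 <= a / 2 ^+ n by rewrite divr_ge0 ?exprn_ge0 // ltW.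
  have -> : a / 2 ^+ n.+1 = (a / 2 ^+ n) / 2 by rewrite exprS invfM mulrA mulrAC.
  by nra.
pose J := (\max_i j i).+1.
have jJ i : (j i < J)%N by rewrite ltnS leq_bigmax.
have [i _||t ht] := @dyadic_cover T j J B a S (ltW a0); first exact: jJ.
  rewrite -(ler_nat R) natrM natr_sum.
  have p0 : 0 < (m * a) ^+ d by rewrite exprn_gt0 // mulr_gt0 //; lra.
  rewrite -(ler_pM2l p0) mulrA [_ * (size B)%:R]mulrC.
  apply: le_trans (ler_wpM2r (ler0n _ _) hB) _.
  rewrite mulr_suml mulr_sumr; apply: ler_sum => i iS.
  have [_ h] := hj i iS; have /andP [l0 _] := hl _ iS.
  have {}h : lam i * 2 ^+ j i <= m * a by rewrite -ler_pdivlMr ?exprn_gt0 // -mulrA.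
  have -> : ((2 ^ (d * J))%N%:R : R) = (2 ^+ j i) ^+ d * (2 ^ (d * (J - j i)))%N%:R.
    rewrite -{1}(subnK (ltnW (jJ i))) mulnDr expnD natrM mulrC !natrX.
    by rewrite -exprM [(j i * d)%N]mulnC.
  rewrite mulrA -exprMn ler_wpM2r //.
  by apply: lerXn2r; rewrite ?nnegrE ?mulr_ge0 ?exprn_ge0 ?(ltW a0) ?(ltW l0) //; lra.
(* [dyadic_cover] places cubes by their lower corner, while the cube inside K is centred at the
   origin. *)
exists (fun i => t i + const_mx (lam i / 2)) => b y bB yb.
have [i iS hi] := ht b y bB yb; exists i => //.
have /andP [l0 _] := hl _ iS; have [h _] := hj i iS.
apply: scaled_cube => // k; rewrite !mxE; have := hi k => /andP [h1 h2].
by rewrite ler_norml; lra.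
Qed.
End Dyadic.

(** * Covering a normalized body *)

Section Core.
Variables (R : realType) (d : nat).
Implicit Types (K : set 'rV[R]_d).

(** For large scales both lattice counts are within 1/5 of their asymptotic values, and (6/5)/(4/5)
    = 3/2. *)
Lemma greedy_ratio K VK VD c : nice K -> is_density K VK -> is_density (diffset K) VD ->
  0 < VK -> 0 < c -> VD <= c * VK ->
  exists2 S : R, 0 < S & forall s m, S <= s -> S <= m * s -> 0 < m ->
    m ^+ d / (3 / 2 * c) * #|` lat (scaled s (diffset K) 0)|%:R <=
    #|` lat (scaled (m * s) K 0)|%:R.
Proof.
move=> nK dK dD VK0 c0 hc.
have e01 : 0 < (1 / 5 : R) < 1 by lra.
have [S1 S1p h1] := dK _ e01; have [S2 S2p h2] := dD _ e01.
exists (S1 + S2) => [|s m hs hms m0]; first by rewrite addr_gt0.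
have /andP [_ hD] := h2 s 0 ltac:(lra).
have /andP [hK _] := h1 (m * s) 0 ltac:(lra).
apply: le_trans hK.
have md0 : 0 < m ^+ d by rewrite exprn_gt0.
have sd0 : 0 < s ^+ d by rewrite exprn_gt0 //; lra.
have q0 : 0 <= m ^+ d / (3 / 2 * c) by rewrite divr_ge0 ?(ltW md0) //; lra.
apply: le_trans (ler_wpM2l q0 hD) _.
have h : VD * s ^+ d <= c * VK * s ^+ d by rewrite ler_pM2r.
apply: (@le_trans _ _ (m ^+ d / (3 / 2 * c) * (6 / 5 * (c * VK * s ^+ d)))).
  by rewrite ler_wpM2l //; lra.
rewrite exprMn le_eqVlt; apply/orP; left; apply/eqP; field.
by rewrite gt_eqF.
Qed.

(* A greedily placed family of the shrunk homothets [(1 - eta) lam i *: K] leaves few lattice points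
   of [s *: K] uncovered. If p is missed by the full homothets, then the cube of side th around
   [(1 - th) *: p] is in K and is missed by the shrunk ones, so each grid cell containing such a p
   accounts for k^d uncovered lattice points; the list B collects the corners of these cells. *)
Lemma large_cover K VK VD c rho (T : finType) (lam : T -> R) (S : {set T}) (delta eta : R) :
  let th := eta * delta / 2 in let a := th / 2 in
  nice K -> spread rho K -> 0 < rho ->
  is_density K VK -> is_density (diffset K) VD -> 0 < VK -> 0 < c -> VD <= c * VK ->
  0 < delta <= 1 -> 0 < eta < 1 -> (forall i, i \in S -> delta <= lam i <= 1) ->
  exists (t : T -> 'rV[R]_d) (B : seq 'rV[R]_d),
    (forall p, K p -> (exists2 i, i \in S & scaled (lam i) K (t i) p) \/
                      (exists2 b, b \in B & cube b a p)) /\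
    (size B)%:R <= (3 * rho / ((1 - th) * a)) ^+ d *
      expR (- \sum_(i in S) ((1 - eta) * lam i) ^+ d / (3 / 2 * c)).
Proof.
move=> th a nK hrho rho0 dK dD VK0 c0 hc /andP [dl0 dl1] /andP [eta0 eta1] hS.
have [cK qK _] := nK.
have thE : th = eta * delta / 2 by [].
have aE : a = th / 2 by [].
clearbody a; clearbody th.
have ed0 : 0 < eta * delta by rewrite mulr_gt0.
have ed1 : eta * delta <= 1 by rewrite mulr_ile1 // ltW.
have th0 : 0 < th by rewrite thE; lra.
have th1 : th <= 1 / 2 by rewrite thE; lra.
have a0 : 0 < a by rewrite aE; lra.
pose h := (1 - th) * a; have h0 : 0 < h by rewrite mulr_gt0 //; lra.
have [S1 S1p ratio] := greedy_ratio nK dK dD VK0 c0 hc.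
pose m i := (1 - eta) * lam i.
have m0 : 0 < (1 - eta) * delta by rewrite mulr_gt0 //; lra.
have hm i : i \in S -> (1 - eta) * delta <= m i <= 1.
  move=> /hS /andP [l1 l2]; apply/andP; split; first by rewrite ler_pM2l //; lra.
  by rewrite mulr_ile1 //; lra.
(* The three terms give s >= S1, then m i * s >= S1 on [S], and s rho >= 1, which turns the count (2
   s rho + 1)^d into (3 rho s)^d. *)
pose M := S1 + S1 / ((1 - eta) * delta) + rho^-1.
have M1 : S1 <= M /\ S1 / ((1 - eta) * delta) <= M /\ rho^-1 <= M.
  have : 0 < rho^-1 by rewrite invr_gt0.
  by have : 0 < S1 / ((1 - eta) * delta) by [rewrite divr_gt0]; rewrite /M; lra.
(* A grid cell of side a, contracted by 1 - th to side h, holds k lattice points per direction at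
   the scale s = k/h. *)
pose k := (Num.truncn (h * M)).+1.
pose s := k%:R / h.
have k0 : 0 < k%:R :> R by rewrite ltr0n.
have s0 : 0 < s by rewrite divr_gt0.
have sM : M <= s by rewrite ler_pdivlMr // mulrC ltW // truncnS_gt.
have srho : 1 <= s * rho.
  by rewrite -ler_pdivrMr // mul1r; lra.
pose X := lat (scaled s K 0).
have hX : #|` X|%:R <= (3 * rho * s) ^+ d.
  have sr0 : 0 <= s * rho by rewrite mulr_ge0 // ltW.
  have [_ hh] := spread_lat sr0 (spread_scaled (t := 0) s0 hrho).
  by apply: le_trans hh _; apply: lerXn2r; rewrite ?nnegrE; lra.
have [//||t ht] := @greedy R d K s T m (fun i => m i ^+ d / (3 / 2 * c)) X (enum S) nK s0 _ (enum_uniq _).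
  move=> i; rewrite mem_enum => /hm /andP [mi1 mi2].
  have mi0 : 0 < m i by lra.
  split; first by rewrite mi0.
  apply: ratio => //; first by lra.
  apply: (@le_trans _ _ ((1 - eta) * delta * s)); last by rewrite ler_pM2r.
  by rewrite -ler_pdivrMl // mulrC; lra.
pose t' i := s^-1 *: zr R (t i).
set X' := [seq z <- X | _] in ht.
pose good p := exists2 i, i \in S & scaled (lam i) K (t' i) p.
pose W := [set w : 'rV[int]_d | exists p, [/\ K p, ~ good p &
  forall i, a * (w 0 i)%:~R <= p 0 i < a * (w 0 i)%:~R + a]]%classic.
have finW : finite_set W.
  have [|//] := @lat_finite_card d W (Num.truncn (rho / a)).+1.
  move=> w w' [p [Kp _ hp]] [p' [Kp' _ hp']] i.
  have := hrho _ _ Kp Kp' i; have /andP [p1 p2] := hp i; have /andP [p3 p4] := hp' i.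
  rewrite ler_norml => /andP [r1 r2].
  have : `|(w 0 i - w' 0 i)%:~R : R| < rho / a + 1.
    rewrite intrB ltr_norml -(ltr_pM2l a0) -[X in _ && X](ltr_pM2l a0).
    have -> : a * - (rho / a + 1) = - rho - a by field; rewrite gt_eqF.
    have -> : a * (rho / a + 1) = rho + a by field; rewrite gt_eqF.
    by lra.
  have := truncnS_gt (rho / a); set n := (Num.truncn _).+1; clearbody n => hn h1.
  have {h1 hn} : `|(w 0 i - w' 0 i)%:~R : R| < n.+1%:~R.
    by rewrite -pmulrn -natr1; lra.
  rewrite -intr_norm ltr_int; move: (w 0 i - w' 0 i) => x; clear; lia.
pose B := [seq a *: zr R w | w <- fset_set W].
exists t', B; split.
  move=> p Kp; case: (pselect (good p)) => [|ngp]; first by left.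
  right; pose w : 'rV[int]_d := \row_i Num.floor (p 0 i / a).
  have hw i : a * (w 0 i)%:~R <= p 0 i < a * (w 0 i)%:~R + a.
    rewrite mxE; have := Num.Theory.floor_itv (p 0 i / a); rewrite intrD => /andP [h1 h2].
    rewrite mulrC -ler_pdivlMr // h1 /=.
    by move: h2; rewrite ltr_pdivrMr // mulrDl mul1r.
  exists (a *: zr R w).
    by apply: map_f; rewrite in_fset_set // inE; exists p.
  by move=> i; rewrite !mxE; have /andP [h1 h2] := hw i; move: h1 h2; rewrite mxE; lra.
have key z (j : 'rV['I_k]_d) : z \in fset_set W -> z *+ k + offset j + 0 \in X'.
  rewrite in_fset_set // inE addr0 => -[p [Kp ngp hp]].
  set x := z *+ k + offset j; pose u := s^-1 *: zr R x.
  (* Both points lie in the cell contracted by 1 - th, whose side is less than a = th/2. *)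
  have hu i : `|u 0 i - (1 - th) * p 0 i| <= th / 2.
    have -> : u 0 i = (1 - th) * (a * (z 0 i)%:~R + a * ((j 0 i : nat)%:R / k%:R)).
      rewrite !mxE mulmxnE rmorphD rmorphMn /= /s /h -[_ *+ k]mulr_natl -pmulrn.
      have ? : 1 - th != 0 by rewrite gt_eqF //; lra.
      field; rewrite ?(gt_eqF k0) ?(gt_eqF a0) //.
    rewrite -mulrBr normrM ger0_norm; last by lra.
    have /andP [p1 p2] := hp i.
    have j1 : 0 <= (j 0 i : nat)%:R / k%:R :> R by rewrite divr_ge0.
    have j2 : (j 0 i : nat)%:R / k%:R <= 1 :> R.
      by rewrite ler_pdivrMr // mul1r ler_nat ltnW.
    have aj1 : 0 <= a * ((j 0 i : nat)%:R / k%:R) by rewrite mulr_ge0 // ltW.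
    have aj2 : a * ((j 0 i : nat)%:R / k%:R) <= a by rewrite ler_piMr // ltW.
    have hn : `|a * (z 0 i)%:~R + a * ((j 0 i : nat)%:R / k%:R) - p 0 i| <= a.
      by rewrite ler_norml; lra.
    by apply: le_trans (ler_piMl _ _) _ => //; lra.
  have Ku : K u.
    have Kq : K (th^-1 *: (u - (1 - th) *: p)).
      apply: qK => i; rewrite !mxE normrM ger0_norm ?invr_ge0 ?(ltW th0) //.
      by rewrite ler_pdivrMl //; have := hu i; rewrite !mxE.
    have := cK _ _ th Kq Kp; rewrite scalerA divff ?gt_eqF // scale1r subrK; apply.
    by lra.
  rewrite mem_filter; apply/andP; split; last first.
    by rewrite in_lat_nice //; apply/asboolP; rewrite /scaled /= subr0.
  apply/allP => i; rewrite mem_enum => iS; apply/negP.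
  have /andP [mi1 mi2] := hm _ iS; have /andP [li1 li2] := hS _ iS.
  have mi0 : 0 < m i by lra.
  rewrite in_lat_nice ?(mulr_gt0 mi0 s0) // => /asboolP Kz; apply: ngp; exists i => //.
  have h1 : scaled (m i) K (t' i) u.
    move: Kz; rewrite /scaled /= subr0 zrB /t' /u -scalerBr scalerA.
    by rewrite invfM [_^-1 * s^-1]mulrC.
  have h2 : scaled th K 0 (th *: p).
    by rewrite /scaled /= subr0 scalerA mulVf ?gt_eqF // scale1r.
  have h3 : scaled th K 0 (- (u - (1 - th) *: p)).
    apply: scaled_cube => // n; have := hu n.
    by rewrite !mxE subr0 normrN.
  (* Writing p = u + th p - (u - (1 - th) p) puts p into a dilate of ratio m i + 2 th = (1 - eta)
     lam i + eta delta <= lam i. *)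
  have h4 := scaled_add cK (addr_gt0 mi0 th0) th0 (scaled_add cK mi0 th0 h1 h2) h3.
  have {h4} : scaled (m i + th + th) K (t' i) p.
    move: h4; rewrite !addr0; congr (scaled _ _ _ _).
    apply/rowP => n; rewrite !mxE; ring.
  apply: scaled_mono => //; first by rewrite !addr_gt0.
  have : eta * delta <= eta * lam i by rewrite ler_pM2l.
  by rewrite /m thE; lra.
have := card_subdiv (fset_uniq _) key.
rewrite -(ler_nat R) natrM natrX => h1.
have kd0 : 0 < k%:R ^+ d :> R by rewrite exprn_gt0.
rewrite size_map -(ler_pM2r kd0); apply: le_trans h1 (le_trans ht _).
have -> : \sum_(i <- enum S) m i ^+ d / (3 / 2 * c) =
          \sum_(i in S) ((1 - eta) * lam i) ^+ d / (3 / 2 * c) by rewrite big_enum.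
rewrite [leLHS]mulrC [leRHS]mulrAC; apply: ler_wpM2r; first exact: expR_ge0.
apply: le_trans hX _; rewrite -exprMn le_eqVlt; apply/orP; left; apply/eqP.
by congr (_ ^+ d); rewrite /s /h; ring.
Qed.
End Core.
Section Normalized.
Variables (R : realType) (d : nat).
Implicit Types (K : set 'rV[R]_d).

Definition covered K (T : finType) (lam : T -> R) :=
  exists t : T -> 'rV[R]_d, forall p, K p -> exists i, scaled (lam i) K (t i) p.

Lemma covered_by_large K (T : finType) (lam : T -> R) i : convex K -> cube_in K -> 1 <= lam i ->
  covered K lam.
Proof.
move=> cK qK l1; exists (fun=> 0) => p Kp; exists i; apply: scaled_mono l1 _ => //.
by rewrite /scaled /= subr0 invr1 scale1r.
Qed.

Lemma spread_sub_cube K rho : K 0 -> spread rho K -> exists b, (K `<=` cube b rho)%classic.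
Proof.
move=> K0 hK; pose E i := [set p 0 i | p in K]%classic.
have lbE i : lbound (E i) (- rho).
  by move=> _ [p Kp <-]; have := hK _ _ Kp K0 i; rewrite !mxE subr0 ler_norml => /andP [].
have hE i : has_inf (E i).
  by split; [exists ((0 : 'rV[R]_d) 0 i); exists 0 | exists (- rho)].
exists (\row_i inf (E i)) => p Kp i; rewrite mxE; apply/andP; split.
  by apply: ge_inf; [case: (hE i) | exists p].
rewrite -lerBlDr; apply: lb_le_inf; first by case: (hE i).
by move=> _ [q Kq <-]; have := hK _ _ Kp Kq i; rewrite ler_norml => /andP [_]; lra.
Qed.

(** If no ratio reaches 1, [tail_cover] with m = 2 covers the single circumscribed cube of side
    [rho]. *)
Lemma normalized_direct K rho (T : finType) (lam : T -> R) : nice K -> spread rho K ->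
  1 <= rho -> (forall i, 0 < lam i) -> (2 * rho) ^+ d <= \sum_i lam i ^+ d -> covered K lam.
Proof.
move=> [cK qK _] hrho rho1 lam0 hsum.
case: (pselect (exists i, 1 <= lam i)) => [[i]|/forallNP hl]; first exact: covered_by_large.
have K0 : K 0 by apply: qK => i; rewrite mxE normr0 invr_ge0.
have [b hb] := spread_sub_cube K0 hrho.
have [||||t ht] := @tail_cover R d K T lam [set: T]%SET [:: b] rho 2 qK; try lra.
- by move=> i _; rewrite lam0 /=; have := hl i; move/negP; rewrite -ltNge; lra.
- rewrite mul1r; apply: le_trans hsum _; rewrite le_eqVlt; apply/orP; left; apply/eqP.
  by apply: eq_bigl => i; rewrite finset.in_setT.
exists t => p /hb pb; have [|i _ hi] := ht b p _ pb; first by rewrite inE.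
by exists i.
Qed.

(** Take an upward closed set of least cardinality with sum at least A. Removing its smallest
    element, whose term is at most 1, drops the sum below A. *)
Lemma upper_subset (T : finType) (w : T -> R) (n : nat) (A : R) : 0 < A -> (forall i, 0 < w i <= 1) ->
  A <= \sum_i w i ^+ n -> exists (S : {set T}) (i0 : T),
  [/\ i0 \in S, forall i, i \in S -> w i0 <= w i, forall i, i \notin S -> w i <= w i0
    & A <= \sum_(i in S) w i ^+ n <= A + 1].
Proof.
move=> A0 w01 hA.
pose P (S : {set T}) := (A <= \sum_(i in S) w i ^+ n) &&
  [forall i in S, forall j, (j \notin S) ==> (w j <= w i)].
have PT : P [set: T]%SET.
  apply/andP; split; last by apply/forall_inP => i _; apply/forallP => j; rewrite finset.in_setT.
  apply: le_trans hA _; rewrite le_eqVlt; apply/orP; left; apply/eqP.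
  by apply: eq_bigl => i; rewrite finset.in_setT.
case: (arg_minnP (fun S : {set T} => #|S|) PT) => S /andP [SA /forall_inP Su] Smin.
have /finset.set0Pn [i1 i1S] : S != finset.set0.
  by apply/eqP => S0; move: SA; rewrite S0 big_set0; lra.
pose i0 := [arg min_(i < i1 in S) w i]%O.
have [i0S i0min] : i0 \in S /\ forall i, i \in S -> w i0 <= w i.
  by rewrite /i0; case: Order.TotalTheory.arg_minP.
exists S, i0; split=> // [i iS|].
  by have /forallP /(_ i) := Su _ i0S; rewrite iS.
rewrite SA /= (big_setD1 i0) //=.
have /andP [w0 w1] := w01 i0.
have : w i0 ^+ n <= 1 by rewrite exprn_ile1 // ltW.
suff : ~~ (A <= \sum_(i in (S :\ i0)%SET) w i ^+ n) by rewrite -ltNge; lra.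
apply/negP => h; have : P (S :\ i0)%SET.
  apply/andP; split=> //; apply/forall_inP => i; rewrite finset.in_setD1 => /andP [ii0 iS].
  apply/forallP => j; apply/implyP; rewrite finset.in_setD1 negb_and negbK.
  case/orP => [/eqP ->|jS]; first exact: i0min.
  by have /forallP /(_ j) := Su _ iS; rewrite jS.
by move/Smin; rewrite (cardsD1 i0 S) i0S add1n ltnn.
Qed.

(** After cancelling delta, the base is 48 d^2 / (1 - th) <= 64 d^2 <= d^5, while exp(-5 d L) <=
    d^(-5d). *)
Lemma numeric_bound (L delta th : R) : (4 <= d)%N -> d%:R <= expR L -> 0 < delta ->
  0 < th <= 1 / 4 ->
  (3 * (2 * d%:R) / ((1 - th) * (delta / (8 * d%:R)))) ^+ d * expR (- (5 * d%:R * L)) * delta ^+ d <= 1.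
Proof.
move=> d4 hL dl0 /andP [th0 th1].
have d0 : 4 <= d%:R :> R by rewrite ler_nat.
have -> : 5 * d%:R * L = (5 * d)%N%:R * L by rewrite natrM.
rewrite mulrAC -exprMn expRN expRM_natl ler_pdivrMr ?exprn_gt0 ?expR_gt0 // mul1r.
rewrite exprM; apply: lerXn2r; rewrite ?nnegrE ?exprn_ge0 ?expR_ge0 //.
  by rewrite mulr_ge0 ?(ltW dl0) // divr_ge0 // !mulr_ge0 ?invr_ge0 ?(ltW dl0) //; lra.
apply: (@le_trans _ _ (d%:R ^+ 5)); last by apply: lerXn2r; rewrite ?nnegrE ?expR_ge0.
have -> : 3 * (2 * d%:R) / ((1 - th) * (delta / (8 * d%:R))) * delta = 48 * d%:R ^+ 2 / (1 - th).
  field; rewrite !gt_eqF //; lra.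
rewrite ler_pdivrMr; last by lra.
have h3 : (4 : R) ^+ 3 <= d%:R ^+ 3 by apply: lerXn2r; rewrite ?nnegrE //; lra.
have h2 : 0 <= d%:R ^+ 2 :> R by rewrite exprn_ge0 //; lra.
have -> : d%:R ^+ 5 = d%:R ^+ 2 * d%:R ^+ 3 :> R by rewrite -exprD.
have h4 : 64 <= d%:R ^+ 3 :> R by apply: le_trans h3; rewrite -natrX ler_nat.
have : d%:R ^+ 2 * 64 <= d%:R ^+ 2 * d%:R ^+ 3 :> R by rewrite ler_wpM2l.
set u := _ ^+ 2 in h2 *; set v := d%:R ^+ 3 in h4 *; nra.
Qed.

(** With eta = 1/(2d), Bernoulli gives (1 - eta)^d >= 1/2, so total volume A = 15 c d L in [S] makes
    the exponent at least A/(3c) = 5 d L. Of the additional 2, one unit is the overshoot of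
    [upper_subset] and the other pays for the remaining cubes. *)
Lemma normalized_greedy K VK VD c L (T : finType) (lam : T -> R) : (4 <= d)%N ->
  nice K -> spread (2 * d%:R) K ->
  is_density K VK -> is_density (diffset K) VD -> 0 < VK -> 0 < c -> VD <= c * VK ->
  d%:R <= expR L -> (forall i, 0 < lam i) ->
  15 * c * d%:R * L + 2 <= \sum_i lam i ^+ d -> covered K lam.
Proof.
move=> d4 nK hK dK dD VK0 c0 hc hL lam0 hsum; have [cK qK _] := nK.
case: (pselect (exists i, 1 <= lam i)) => [[i]|/forallNP hl]; first exact: covered_by_large.
have lam1 i : 0 < lam i <= 1.
  by rewrite lam0 /=; have := hl i; move/negP; rewrite -ltNge => /ltW.
have d4R : 4 <= d%:R :> R by rewrite ler_nat.
have dpos : 0 < d%:R :> R by lra.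
have L0 : 0 < L by rewrite -expR_gt1; lra.
pose A := 15 * c * d%:R * L.
have A0 : 0 < A by rewrite !mulr_gt0.
have [|S [i0 [i0S hS hnS /andP [SA SA1]]]] := @upper_subset T lam d A A0 lam1.
  by rewrite /A; lra.
pose eta : R := (2 * d%:R)^-1.
have eta0 : 0 < eta by rewrite invr_gt0; lra.
have etad : d%:R * eta = 1 / 2 by rewrite /eta; field; lra.
have eta1 : eta <= 1 / 8 by nra.
have /andP [dl0 dl1] := lam1 i0.
set delta := lam i0 in dl0 dl1 hS hnS.
have rho0 : 0 < 2 * d%:R :> R by lra.
have [|||t1 [B [cov hB]]] :=
  @large_cover R d K VK VD c _ T lam S delta eta nK hK rho0 dK dD VK0 c0 hc.
- by rewrite dl0.
- by lra.
- by move=> i iS; rewrite hS //=; case/andP: (lam1 i).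
set th := eta * delta / 2 in cov hB.
have aE : th / 2 = delta / (8 * d%:R) by rewrite /th /eta; field; lra.
have th0 : 0 < th by rewrite /th divr_gt0 // mulr_gt0.
have th1 : th <= 1 / 4.
  by have := ler_pM (ltW eta0) (ltW dl0) eta1 dl1; rewrite /th; lra.
rewrite aE in cov hB.
have maE : 8 * d%:R * (delta / (8 * d%:R)) = delta by field; lra.
have hE : (size B)%:R * delta ^+ d <= 1.
  have h1 := @numeric_bound L delta th d4 hL dl0 ltac:(lra).
  apply: le_trans h1; apply: ler_wpM2r; first by rewrite exprn_ge0 // ltW.
  apply: le_trans hB _; apply: ler_wpM2l.
    rewrite exprn_ge0 // divr_ge0 //; first by lra.
    by rewrite mulr_ge0 ?divr_ge0 //; lra.
  rewrite ler_expR lerN2.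
  apply: (@le_trans _ _ (\sum_(i in S) (1 / 2) / (3 / 2 * c) * lam i ^+ d)).
    rewrite -mulr_sumr; apply: (@le_trans _ _ (1 / 2 / (3 / 2 * c) * A)).
      by rewrite le_eqVlt; apply/orP; left; apply/eqP; rewrite /A; field; lra.
    by rewrite ler_wpM2l // divr_ge0 //; lra.
  apply: ler_sum => i _; rewrite exprMn [leRHS]mulrAC; apply: ler_wpM2r.
    by rewrite exprn_ge0 // ltW.
  rewrite ler_wpM2r ?invr_ge0 //; first by lra.
  have := @bernoulli R eta d ltac:(lra); rewrite etad; lra.
(* The factor m = 8d makes m a = delta, which bounds every ratio outside [S]; the volume required is
   then |B| delta^d <= 1. *)
have [||||t2 ht2] := @tail_cover R d K T lam (~: S)%SET B (delta / (8 * d%:R)) (8 * d%:R) qK.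
- by rewrite divr_gt0 //; lra.
- by lra.
- by move=> i; rewrite finset.in_setC maE lam0 /= => /hnS.
- rewrite maE; apply: le_trans hE _.
  have : \sum_i lam i ^+ d = \sum_(i in S) lam i ^+ d + \sum_(i in (~: S)%SET) lam i ^+ d.
    by rewrite (bigID (mem S)) /=; congr (_ + _); apply: eq_bigl => i; rewrite finset.in_setC.
  by move: hsum SA1; rewrite -/A; lra.
exists (fun i => if i \in S then t1 i else t2 i) => p /cov [[i iS hi]|[b bB hb]].
  by exists i; rewrite iS.
have [i] := ht2 b p bB hb; rewrite finset.in_setC => iS hi; exists i.
by rewrite (negbTE iS).
Qed.
End Normalized.
(** * Normalizing coordinates *)

Section Coordinates.
Variables (R : realType) (d : nat).
Implicit Types (K D : set 'rV[R]_d) (x y : 'rV[R]_d).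

Lemma convex_avg K (n : nat) (p : 'I_n -> 'rV[R]_d) : (0 < n)%N -> convex K ->
  (forall i, K (p i)) -> K (n%:R^-1 *: \sum_i p i).
Proof.
case: n p => // n p _ cK; elim: n p => [|n IH] p Kp.
  by rewrite big_ord1 invr1 scale1r.
rewrite big_ord_recl scalerDr.
have := cK _ _ n.+2%:R^-1 (Kp ord0) (IH (fun i => p (lift ord0 i)) (fun i => Kp _)).
have n1 : 0 < n.+1%:R :> R by rewrite ltr0n.
have n2 : n.+2%:R = n.+1%:R + 1 :> R by rewrite -natr1.
rewrite scalerA.
have -> : (1 - n.+2%:R^-1) * n.+1%:R^-1 = n.+2%:R^-1 :> R.
  by rewrite n2; field; rewrite !gt_eqF //; lra.
apply; rewrite n2 invr_ge0 invf_le1; lra.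
Qed.

Definition replace_row (i : 'I_d) (y : 'rV[R]_d) (A : 'M[R]_d) : 'M[R]_d :=
  \matrix_(k, j) (if k == i then y 0 j else A k j).

Lemma cramer_row (A : 'M[R]_d) (y : 'rV[R]_d) i : A \in unitmx ->
  (y *m invmx A) 0 i = \det (replace_row i y A) / \det A.
Proof.
move=> uA; rewrite (expand_det_row _ i) /invmx uA -scalemxAr !mxE mulrC; congr (_ * _).
apply: eq_bigr => j _; rewrite !mxE eqxx; congr (_ * (_ * \det _)).
apply/matrixP => k l; rewrite !mxE ifF //.
by apply/negbTE; rewrite eq_sym; apply: neq_lift.
Qed.

(* Rows of almost maximal determinant: by Cramer's rule, D has small coordinates in that basis. *)
Lemma near_maximal_basis D (M r eps : R) : 0 < r -> 1 < eps ->
  (forall x, D x -> forall i, `|x 0 i| <= M) -> (forall i, D (r *: delta_mx 0 i)) ->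
  exists A : 'M[R]_d, [/\ A \in unitmx, forall i, D (row i A) &
    forall y, D y -> forall i, `|(y *m invmx A) 0 i| <= eps].
Proof.
move=> r0 e1 hM hr.
pose E := [set m : R | exists2 A : 'M[R]_d, (forall i, D (row i A)) & m = `|\det A|]%classic.
have ubE : ubound E (\sum_(s : {perm 'I_d}) \prod_(i < d) M).
  move=> _ [A hA ->]; rewrite /determinant; apply: le_trans (ler_norm_sum _ _ _) _.
  apply: ler_sum => s _; rewrite normrM normr_sign mul1r normr_prod.
  apply: ler_prod => i _; rewrite normr_ge0 /=.
  by have := hM _ (hA i) (s i); rewrite mxE.
have Er : E (r ^+ d).
  exists (r%:M) => [i|]; last by rewrite det_scalar ger0_norm // exprn_ge0 // ltW.
  by rewrite -scalemx1 linearZ /= row1.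
have hE : has_sup E by split; [exists (r ^+ d) | exists (\sum_(s : {perm 'I_d}) \prod_(i < d) M)].
have s0 : 0 < sup E.
  by apply: lt_le_trans (_ : r ^+ d <= _); rewrite ?exprn_gt0 //; apply: ub_le_sup => //; case: hE.
(* D is not assumed closed, so the supremum of the determinants is only approached, within the
   factor [eps]. *)
have gap : 0 < sup E - sup E / eps.
  by rewrite subr_gt0 ltr_pdivrMr ?ltr_pMr //; lra.
have [_ [A hA ->]] := sup_adherent gap hE; rewrite opprB addrC subrK => hdet.
have det0 : 0 < `|\det A|.
  by apply: le_lt_trans hdet; rewrite divr_ge0 // ltW //; lra.
have uA : A \in unitmx by rewrite unitmxE unitfE -normr_gt0.
exists A; split=> // y Dy i; rewrite cramer_row // normrM normfV ler_pdivrMr //.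
apply: (@le_trans _ _ (sup E)); last first.
  by rewrite ltW // mulrC -ltr_pdivrMr //; lra.
apply: ub_le_sup; first by case: hE.
exists (replace_row i y A) => // k; have [->|ki] := eqVneq k i.
  by rewrite (_ : row i _ = y) //; apply/rowP => j; rewrite !mxE eqxx.
by rewrite (_ : row k _ = row k A) //; apply/rowP => j; rewrite !mxE (negbTE ki).
Qed.

(** The rows of A are differences of endpoints of chords of K. With b the average of the midpoints,
    A/d + b maps the unit cube to averages of points on these chords, hence into K. Elements of K -
    K have coordinates at most [eps] with respect to A, so at most d eps with respect to A/d. *)
Lemma normalizing_coordinates K (M r eps : R) (x0 : 'rV[R]_d) : (0 < d)%N -> convex K ->
  (forall x, K x -> forall i, `|x 0 i| <= M) -> 0 < r ->
  (forall y, (forall i, `|y 0 i - x0 0 i| <= r) -> K y) -> 1 < eps ->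
  exists (P : 'M[R]_d) (b : 'rV[R]_d), [/\ P \in unitmx,
    nice [set y | K (y *m P + b)]%classic & spread (d%:R * eps) [set y | K (y *m P + b)]%classic].
Proof.
move=> d0 cK hM r0 hr e1.
have [x Dx i|i|A [uA hA hy]] := @near_maximal_basis (diffset K) (2 * M) r eps r0 e1.
- case: Dx => [u [v [Ku Kv ->]]]; rewrite !mxE; apply: le_trans (ler_normB _ _) _.
  by have := hM _ Ku i; have := hM _ Kv i; lra.
- exists (x0 + r *: delta_mx 0 i), x0; split; last by rewrite addrAC subrr add0r.
  + apply: hr => j; rewrite !mxE addrAC subrr add0r normrM (gtr0_norm r0) ler_piMr ?(ltW r0) //.
    by case: (_ && _); rewrite ?normr1 ?normr0.
  + by apply: hr => j; rewrite subrr normr0 ltW.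
have /choice [ab hab] : forall i, exists p : 'rV[R]_d * 'rV[R]_d,
    [/\ K p.1, K p.2 & row i A = p.1 - p.2].
  by move=> i; have [u [v huv]] := hA i; exists (u, v).
have dR : 0 < d%:R :> R by rewrite ltr0n.
have dn : d%:R != 0 :> R by rewrite gt_eqF.
pose b := d%:R^-1 *: \sum_i 2^-1 *: ((ab i).1 + (ab i).2).
exists (d%:R^-1 *: A), b.
have cK' : convex [set y | K (y *m (d%:R^-1 *: A) + b)]%classic.
  move=> x y s /= Kx Ky hs; have := cK _ _ s Kx Ky hs; congr K.
  rewrite mulmxDl -!scalemxAl !scalerDr addrACA -scalerDl.
  by have -> : s + (1 - s) = 1 by [ring]; rewrite scale1r.
have sp : spread (d%:R * eps) [set y | K (y *m (d%:R^-1 *: A) + b)]%classic.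
  move=> x y /= Kx Ky i.
  have : diffset K ((x - y) *m (d%:R^-1 *: A)).
    exists (x *m (d%:R^-1 *: A) + b), (y *m (d%:R^-1 *: A) + b); split=> //.
    by rewrite mulmxBl opprD addrACA subrr addr0.
  move=> /hy /(_ i); rewrite -scalemxAr -scalemxAl mulmxK // !mxE normrM normfV normr_nat.
  by rewrite ler_pdivrMl.
split; [|split=> // | exact: sp].
- by rewrite unitmxZ // unitfE invr_eq0.
- move=> q hq /=.
  have -> : q *m (d%:R^-1 *: A) + b = d%:R^-1 *: \sum_i ((q 0 i + 2^-1) *: (ab i).1 +
      (1 - (q 0 i + 2^-1)) *: (ab i).2).
    rewrite -scalemxAr /b -scalerDr; congr (_ *: _).
    rewrite mulmx_sum_row -big_split /=; apply: eq_bigr => i _.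
    have [_ _ ->] := hab i; apply/rowP => j; rewrite !mxE.
    by field.
  apply: convex_avg => // i.
  have [K1 K2 _] := hab i; apply: (cK _ _ _ K1 K2).
  by have := hq i; rewrite ler_norml; lra.
- exists (d%:R * eps) => //; rewrite mulr_ge0 ?(ltW dR) //; lra.
Qed.

(** Affine maps preserve ratios of homothety; the shift by b contributes b - lam i b to each
    translation. *)
Lemma covered_affine K (P : 'M[R]_d) (b : 'rV[R]_d) (T : finType) (lam : T -> R) :
  P \in unitmx -> (forall i, 0 < lam i) ->
  covered [set y | K (y *m P + b)]%classic lam -> covered K lam.
Proof.
move=> uP lam0 [t ht]; exists (fun i => t i *m P + b - lam i *: b) => p Kp.
have := ht ((p - b) *m invmx P); rewrite /= mulmxKV // subrK => /(_ Kp) [i].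
rewrite /scaled /= => hi; exists i; rewrite /scaled /=; move: hi; congr K.
have l0 : lam i != 0 by rewrite gt_eqF.
rewrite -scalemxAl mulmxBl mulmxKV // -[b in _ + b](scalerK l0) -scalerDr; congr (_ *: _).
by apply/rowP => j; rewrite !mxE; ring.
Qed.

Lemma symmetric_affine K (P : 'M[R]_d) (b : 'rV[R]_d) : P \in unitmx ->
  (forall x, K x -> K (- x)) ->
  exists tau, forall x, K (x *m P + b) -> K ((tau - x) *m P + b).
Proof.
move=> uP sK; exists (- (b + b) *m invmx P) => x /sK; congr K.
by rewrite mulmxBl mulmxKV //; apply/rowP => j; rewrite !mxE; ring.
Qed.

(** The values of c for which vol(K - K) <= c vol(K) is proved: by central symmetry, or by
    Rogers-Shephard. *)
Definition hitting_constant K (c : R) :=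
  ((forall x, K x -> K (- x)) /\ c = 2 ^+ d) \/ c = 'C(2 * d, d)%:R.

Lemma cover_direct K (M r : R) (x0 : 'rV[R]_d) (T : finType) (lam : T -> R) : (0 < d)%N ->
  convex K -> (forall x, K x -> forall i, `|x 0 i| <= M) -> 0 < r ->
  (forall y, (forall i, `|y 0 i - x0 0 i| <= r) -> K y) -> (forall i, 0 < lam i) ->
  (2 * (d%:R * (101 / 100))) ^+ d <= \sum_i lam i ^+ d -> covered K lam.
Proof.
move=> d0 cK hM r0 hr lam0 hsum.
have e1 : 1 < 101 / 100 :> R by lra.
have [P [b [uP nK sp]]] := normalizing_coordinates d0 cK hM r0 hr e1.
apply: (covered_affine uP lam0); apply: normalized_direct nK sp _ lam0 hsum.
by have : 1 <= d%:R :> R; [rewrite ler1n | lra].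
Qed.

Lemma cover_greedy K (M r c L : R) (x0 : 'rV[R]_d) (T : finType) (lam : T -> R) : (4 <= d)%N ->
  convex K -> (forall x, K x -> forall i, `|x 0 i| <= M) -> 0 < r ->
  (forall y, (forall i, `|y 0 i - x0 0 i| <= r) -> K y) -> (forall i, 0 < lam i) ->
  hitting_constant K c -> d%:R <= expR L ->
  15 * c * d%:R * L + 2 <= \sum_i lam i ^+ d -> covered K lam.
Proof.
move=> d4 cK hM r0 hr lam0 hc hL hsum.
have d0 : (0 < d)%N by apply: leq_trans d4.
have e1 : 1 < 101 / 100 :> R by lra.
have [P [b [uP nK sp]]] := normalizing_coordinates d0 cK hM r0 hr e1.
apply: (covered_affine uP lam0).
have [VK VK0 dK] := density_exists nK.
have [VD VD0 dD] := density_exists (nice_diffset nK).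
have dR : 1 <= d%:R :> R by rewrite ler1n.
have sp2 : spread (2 * d%:R) [set y | K (y *m P + b)]%classic.
  by move=> x y Kx Ky i; apply: le_trans (sp _ _ Kx Ky i) _; lra.
have c0 : 0 < c.
  by case: hc => [[_ ->]|->]; rewrite ?exprn_gt0 // ltr0n bin_gt0; lia.
apply: (normalized_greedy d4 nK sp2 dK dD VK0 c0 _ hL lam0 hsum).
case: hc => [[sK ->]|->]; last exact: rogers_shephard d0 nK dK dD VK0 VD0.
by apply: (sym_density nK dK dD VK0 VD0); exact: symmetric_affine.
Qed.
End Coordinates.

From mathcomp Require Import Rstruct Rstruct_topology.
Local Notation R := Rdefinitions.R.

(** * Transfer to points of type [pt] *)

Lemma IZR_natr (n : nat) : Rdefinitions.IZR (BinInt.Z.of_nat n) = n%:R :> R.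
Proof. by rewrite -INRE RIneq.INR_IZR_INZ. Qed.

Lemma C_bin (n m : nat) : (m <= n)%N -> Binomial.C n m = ('C(n, m))%:R :> R.
Proof.
move=> mn; rewrite /Binomial.C !factE !INRE.
rewrite RdivE RmultE -natrM.
have -> : (n - m)%coq_nat = (n - m)%N by [].
rewrite -(bin_fact mn) natrM mulfK // pnatr_eq0 muln_eq0.
by rewrite negb_or -!lt0n !fact_gt0.
Qed.

Lemma expn2_le_bin (d : nat) : (2 ^ d <= 'C(2 * d, d))%N.
Proof.
elim: d => [//|d IH].
have -> : (2 * d.+1 = (2 * d).+2)%N by lia.
rewrite binS expnS mul2n -addnn; apply: leq_add.
  by apply: leq_trans IH _; rewrite binS leq_addl.
by case: d IH => [//|d] IH; apply: leq_trans IH _; rewrite binS leq_addr.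
Qed.

Lemma bin_le_expn2 (n m : nat) : ('C(n, m) <= 2 ^ n)%N.
Proof.
elim: n m => [|n IH] [|m]; rewrite ?bin0 ?expn_gt0 //.
by rewrite binS expnS mul2n -addnn leq_add.
Qed.

Section Bridge.
Variable d : nat.

Definition row_of (y : pt) : 'rV[R]_d := \row_i y i.
Definition pt_of (v : 'rV[R]_d) : pt := fun n => if insub n is Some i then v 0 i else 0.

Lemma pt_of_ord v (i : 'I_d) : pt_of v i = v 0 i.
Proof. by rewrite /pt_of valK. Qed.

Lemma pt_of_out v n : (d <= n)%N -> pt_of v n = 0.
Proof. by move=> dn; rewrite /pt_of insubF // ltnNge dn. Qed.

Lemma pt_of_in_Rd v : in_Rd d (pt_of v).
Proof. by move=> n /ssrnat.leP; exact: pt_of_out. Qed.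

Lemma row_ofK y : in_Rd d y -> pt_of (row_of y) = y.
Proof.
move=> yd; apply/funext => n; case: (ltnP n d) => [nd|dn].
  by rewrite -[n]/(nat_of_ord (Ordinal nd)) pt_of_ord mxE.
by rewrite pt_of_out // yd //; apply/ssrnat.leP.
Qed.

Lemma pt_of_comb (a b : R) v w :
  pt_of (a *: v + b *: w) = ptadd (ptscal a (pt_of v)) (ptscal b (pt_of w)).
Proof.
apply/funext => n; rewrite /ptadd /ptscal !RplusE !RmultE; case: (ltnP n d) => [nd|dn].
  by rewrite -[n]/(nat_of_ord (Ordinal nd)) !pt_of_ord !mxE.
by rewrite !pt_of_out // !mulr0 addr0.
Qed.

Lemma sum_list_big {A : Type} (f : A -> R) (l : seq A) : sum_list f l = \sum_(a <- l) f a.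
Proof. by elim: l => [|a l IH] /=; rewrite ?big_nil // big_cons -IH. Qed.

(** The homothets are indexed by positions in a list, which form a finite type; positions past its
    end get the zero translation. *)
Lemma finite_covering (K : pt -> Prop) (ls : seq R) (c : R) : (0 < d)%N -> convex_body d K ->
  (forall n, (n < size ls)%N -> 0 < ls`_n) ->
  (centrally_symmetric K /\ c = Rpow_def.pow 2 d) \/ c = Binomial.C (2 * d) d ->
  c * (Raxioms.INR d ^+ 3 * Rpower.ln (Raxioms.INR d) + Rtrigo_def.exp 1) - 1 <=
    \sum_(a <- ls) a ^+ d ->
  exists t : nat -> 'rV[R]_d, forall y, K y -> exists2 n, (n < size ls)%N &
    exists2 k, K k & y = ptadd (ptscal (ls`_n) k) (pt_of (t n)).
Proof.
move=> d0 [Kd [Kconv [[M KM] [_ [x0 [r [r0 Kr]]]]]]] ls0 hc hsum.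
pose K' : set 'rV[R]_d := [set v | K (pt_of v)]%classic.
have cK : convex K'.
  move=> x y s Kx Ky hs; rewrite /K' /= pt_of_comb; apply: Kconv => //.
  by case/andP: hs => /RleP ? /RleP.
have bK v : K' v -> forall i, `|v 0 i| <= M.
  by move=> /KM h i; have /RleP := h i; rewrite pt_of_ord RabsE.
have dR : 1 <= d%:R :> R by rewrite ler1n.
move/RltP: (r0) => r0'; pose rho := r / (2 * d%:R).
have rho0 : 0 < rho by rewrite divr_gt0 //; lra.
have iK (v : 'rV[R]_d) : (forall i, `|v 0 i - (row_of x0) 0 i| <= rho) -> K' v.
  move=> hv; apply: Kr; first exact: pt_of_in_Rd.
  apply: dist_lt_of_coordinates => //; first exact/ssrnat.leP.
  move=> i /ssrnat.leP id; apply/RleP.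
  have := hv (Ordinal id); rewrite mxE distrC -pt_of_ord RabsE RminusE RdivE RmultE INRE.
  by [].
pose lam (n : 'I_(size ls)) := ls`_n.
have lam0 n : 0 < lam n by apply: ls0.
have sumE : \sum_n lam n ^+ d = \sum_(a <- ls) a ^+ d.
  by rewrite (big_nth 0) big_mkord.
have hc' : hitting_constant K' c.
  case: hc => [[sK ->]|->]; [left|right].
    split; last by rewrite RpowE.
    move=> v /sK; rewrite /K' /=; congr K; apply/funext => n; rewrite /ptopp RoppE.
    by rewrite -[- v]scaleN1r -[_ *: v]addr0 -(scale0r v) pt_of_comb /ptadd /ptscal
       !RplusE !RmultE mulN1r mul0r addr0.
  by rewrite C_bin // mul2n -addnn leq_addr.
have c2 : (2 : R) ^+ d <= c.
  case: hc => [[_ ->]|->]; first by rewrite RpowE.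
  have le2d : (d <= 2 * d)%N by rewrite leq_pmull.
  have := expn2_le_bin d; rewrite -(ler_nat R) natrX.
  by rewrite C_bin.
have cov : covered K' lam.
  have c2' : Rdefinitions.Rle (Rpow_def.pow 2 d) c by apply/RleP; rewrite RpowE.
  case: (leqP d 3) => d3.
    apply: (@cover_direct _ d K' M rho (row_of x0)) => //; rewrite sumE; apply: le_trans hsum.
    have /RleP := @numeric_small d c ltac:(by split; apply/ssrnat.leP) c2'.
    by rewrite !(RpowE, RmultE, RplusE, RminusE, RdivE, INRE) (IZR_natr 101) (IZR_natr 100) (IZR_natr 2).
  apply: (@cover_greedy _ d K' M rho c (Rpower.ln (Raxioms.INR d)) (row_of x0)) => //.
    by rewrite -RexpE Rpower.exp_ln ?INRE //; apply/RltP; rewrite ltr0n.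
  rewrite sumE; apply: le_trans hsum.
  have /RleP := @numeric_large d c ltac:(by apply/ssrnat.leP) c2'.
  by rewrite !(RpowE, RmultE, RplusE, RminusE, RdivE, INRE) (IZR_natr 15) (IZR_natr 2).
have [t ht] := cov.
exists (fun n => if insub n is Some i then t i else 0) => y Ky.
have yd := Kd y Ky.
have [|i hi] := ht (row_of y); first by rewrite /K' /= row_ofK.
exists i; first exact: ltn_ord.
exists (pt_of ((lam i)^-1 *: (row_of y - t i))) => //.
rewrite valK; have := pt_of_comb (lam i) 1 ((lam i)^-1 *: (row_of y - t i)) (t i).
rewrite scalerA divff ?gt_eqF // !scale1r subrK row_ofK // => e; rewrite [LHS]e.
by congr (ptadd _ _); apply/funext => n; rewrite /ptscal RmultE mul1r.
Qed.
End Bridge.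

(** * Finite families of homothets and the theorem *)

Lemma nth_error_map_nth {A : Type} (f : A -> R) (l : seq A) n i :
  List.nth_error l n = Some i -> [seq f i | i <- l]`_n = f i.
Proof. by elim: l n => [|a l IH] [|n] //= => [[->]|/IH]. Qed.

Local Open Scope R_scope.

(** In the general case this lets the term e 4^d pay for e C(2d, d). *)
Lemma C_le_pow4 (d : nat) : 0 <= Binomial.C (2 * d) d <= 4 ^ d.
Proof.
have h : (d <= 2 * d)%N by rewrite mul2n -addnn leq_addr.
rewrite C_bin // RpowE; split; apply/RleP; first exact: ler0n.
have -> : (4 : R) = 4%:R%R by rewrite (IZR_natr 4).
by rewrite -natrX ler_nat -[4%N]/(2 ^ 2)%N -expnM bin_le_expn2.
Qed.

Lemma finite_family_covers (d : nat) (K : pt -> Prop) (I : Type) (lam : I -> R) (x : I -> pt)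
  (l : list I) (c : R) : (1 <= d)%coq_nat -> convex_body d K -> (forall i, lam i > 0) ->
  (forall i, in_Rd d (x i)) -> List.NoDup l ->
  (centrally_symmetric K /\ c = 2 ^ d) \/ c = Binomial.C (2 * d) d ->
  c * (INR d ^ 3 * Rpower.ln (INR d) + Rtrigo_def.exp 1) - 1 <= sum_list (fun i => lam i ^ d) l ->
  permits_translative_covering d (fun i => homothet (lam i) (x i) K) K.
Proof.
move=> /ssrnat.leP d0 hK lam0 hx ul hc hsum.
have [||t ht] := @finite_covering d K [seq lam i | i <- l] c d0 hK _ hc.
- move=> n; rewrite size_map => nl.
  case e : (List.nth_error l n) => [i|].
    by rewrite (nth_error_map_nth _ e); apply/RltP; exact: lam0.
  by move/List.nth_error_None : e => /ssrnat.leP; rewrite leqNgt nl.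
- rewrite big_map; under eq_bigr => i _ do rewrite -RpowE.
  by move/RleP: hsum; rewrite sum_list_big RpowE.
have [t0 ht0] := list_assign (0 : 'rV[R]_d)%R l t ul.
(* The given homothet is already shifted by [x i], so that shift is subtracted. *)
exists (fun i => ptsub (pt_of (t0 i)) (x i)); split.
  by move=> i n dn; rewrite /ptsub (hx i n dn) pt_of_in_Rd // RminusE subr0.
move=> y Ky; have [n + [k Kk yE]] := ht y Ky; rewrite size_map => nl.
case e : (List.nth_error l n) => [i|]; last first.
  by move/List.nth_error_None : e => /ssrnat.leP; rewrite leqNgt nl.
exists i, k; split=> //; rewrite yE (nth_error_map_nth _ e) (ht0 _ _ e).
apply/funext => m; rewrite /ptsub /ptadd /ptscal !(RminusE, RplusE, RmultE).
by ring.
Qed.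

End LatticeCounting.

Theorem theorem1p2 (d : nat) (hd : (1 <= d)%nat) (K : pt -> Prop)
  (hK : convex_body d K) (hvol : is_vol d K 1)
  (th : R) (hth : is_theta d K th)
  (I : Type) (lam : I -> R) (x : I -> pt)
  (hlam : forall i, lam i > 0) (hx : forall i, in_Rd d (x i)) :
  let F := fun i => homothet (lam i) (x i) K in
  let dd := INR d in
  (centrally_symmetric K /\
     total_vol_ge d F ((dd ^ 3 * ln dd * th + exp 1) * 2 ^ d))
  \/ total_vol_ge d F (dd ^ 3 * ln dd * th * C (2 * d) d + exp 1 * 4 ^ d) ->
  permits_translative_covering d F K.
Proof.
intros F dd H.
assert (Hth : 1 <= th) by exact (theta_ge1 d K th hd hK hvol hth).
assert (Hdd : 1 <= dd) by (unfold dd; replace 1 with (INR 1) by reflexivity; apply le_INR; lia).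
assert (Hln : 0 <= dd ^ 3 * ln dd).
{ apply Rmult_le_pos; [apply pow_le; lra|]. rewrite <- ln_1.
  destruct Hdd as [Hdd|<-]; [left; apply ln_increasing; lra | lra]. }
(* The covering density enters only through th >= 1. *)
assert (Hmain : dd ^ 3 * ln dd <= dd ^ 3 * ln dd * th).
{ rewrite <- (Rmult_1_r (dd ^ 3 * ln dd)) at 1. apply Rmult_le_compat_l; lra. }
destruct (LatticeCounting.C_le_pow4 d) as [HC0 HC4].
(* The loss 1 in passing to a finite list is the [- 1] allowed by [finite_family_covers]. *)
destruct H as [[Hsym H]|H];
  apply (total_vol_homothets d K lam x _ 1 hvol hlam hx Rlt_0_1) in H; destruct H as [l [Hl Hs]].
- apply (@LatticeCounting.finite_family_covers d K I lam x l (2 ^ d)); auto.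
  eapply Rle_trans; [|exact Hs]. unfold Rminus. apply Rplus_le_compat_r.
  rewrite Rmult_comm. apply Rmult_le_compat_r; [apply pow_le; lra | fold dd; lra].
- apply (@LatticeCounting.finite_family_covers d K I lam x l (C (2 * d) d)); auto.
  eapply Rle_trans; [|exact Hs]. unfold Rminus. apply Rplus_le_compat_r. fold dd.
  rewrite Rmult_plus_distr_l. apply Rplus_le_compat.
  + rewrite Rmult_comm. apply Rmult_le_compat_r; assumption.
  + rewrite Rmult_comm. apply Rmult_le_compat_l; [left; apply exp_pos | assumption].
Qed.
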